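(* Let $\mathcal H\colon\mathbb R^{p_1}\times\mathbb R^{p_2}\to\mathbb R^{q_1}$ and $\mathcal G\colon\mathbb R^{p_1}\times\mathbb R^{p_2}\to\mathbb R^{p_2}$ be continuously differentiable, and let $\{z^k\}_{k\in\mathbb N}$ be a sequence generated by the global nonsmooth Levenberg--Marquardt method described in the context. (a) If the test $\Psi_{\mathrm{FB}}(z^k+d^k)\le\kappa\Psi_{\mathrm{FB}}(z^k)$ in step 2 of the method holds infinitely many times, then $\{\Psi_{\mathrm{FB}}(z^k)\}_{k\in\mathbb N}$ is a null sequence, and each accumulation point of $\{z^k\}_{k\in\mathbb N}$ is a solution of the mixed nonlinear complementarity system $$\mathcal H(w,\xi)=0,\quad \mathcal G(w,\xi)\le0,\quad \xi\ge0,\quad \mathcal G(w,\xi)^\top\xi=0.\qquad(\mathrm{MNLCS})$$ (b) Each accumulation point of $\{z^k\}_{k\in\mathbb N}$ is a stationary point of $\Psi_{\mathrm{FB}}$ (i.e. $\nabla\Psi_{\mathrm{FB}}$ vanishes there). (c) Suppose an accumulation point $\bar z=(\bar w,\bar\xi)$ of $\{z^k\}_{k\in\mathbb N}$ is a solution of (MNLCS) such that for each index set $I\subset I^{00}(\bar w,\bar\xi)$, with $I_{\mathrm c}:=I^{00}(\bar w,\bar\xi)\setminus I$, the matrix $$\begin{bmatrix}\mathcal H'_w(\bar w,\bar\xi)&\mathcal H'_\xi(\bar w,\bar\xi)\\ \mathcal G'_w(\bar w,\bar\xi)_{I^+(\bar w,\bar\xi)\cup I}&\mathcal G'_\xi(\bar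 w,\bar\xi)_{I^+(\bar w,\bar\xi)\cup I}\\ \mathbb O&-\mathbb I^{p_2}_{I^-(\bar w,\bar\xi)\cup I_{\mathrm c}}\end{bmatrix}$$ possesses linearly independent columns. Then the whole sequence $\{z^k\}_{k\in\mathbb N}$ converges to $\bar z$ superlinearly. If the derivatives of $\mathcal G$ and $\mathcal H$ are locally Lipschitz continuous functions, then the convergence is even quadratic.
   Context: Norms are Euclidean. $\mathbb I^n$ is the $n\times n$ identity matrix, $\mathbb O$ a zero matrix; for a matrix $A$ and a set $I$ of row indices, $A_I$ is the submatrix of $A$ consisting of the rows with index in $I$. Write $z=(w,\xi)\in\mathbb R^{p_1}\times\mathbb R^{p_2}$, $p:=p_1+p_2$. $\mathcal G_1,\dots,\mathcal G_{p_2}$ are the components of $\mathcal G$; $\mathcal H'_w,\mathcal H'_\xi$, etc. are partial Jacobians. Index sets: $I^0(w,\xi)=\{i\mid\mathcal G_i(w,\xi)=0\}$, $I^-(w,\xi)=\{i\mid\mathcal G_i(w,\xi)<0\}$, $I^+(w,\xi)=\{i\in I^0(w,\xi)\mid\xi_i>0\}$, $I^{00}(w,\xi)=\{i\in I^0(w,\xi)\mid\xi_i=0\}$, $I^{\ge}(w,\xi)=\{i\mid\mathcal G_i(w,\xi)\ge-\xi_i\}$, $I^{<}(w,\xi)=\{i\mid\mathcal G_i(w,\xi)<-\xi_i\}$, where $i$ ranges over $\{1,\dots,p_2\}$. For $I\subset\{1,\dots,p_2\}$, $\mathbb D(I)\in\mathbb R^{p_2\times p_2}$ is the diagonal matrix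 with $i$-th diagonal entry $1$ if $i\in I$ and $0$ otherwise. Residuals: $\varphi_{\mathrm{FB}}(a,b):=a+b+\sqrt{a^2+b^2}$ is the Fischer--Burmeister function, and $$\mathcal F_{\max}(w,\xi):=\begin{bmatrix}\mathcal H(w,\xi)\\ \max(\mathcal G(w,\xi),-\xi)\end{bmatrix},\qquad \mathcal F_{\mathrm{FB}}(w,\xi):=\begin{bmatrix}\mathcal H(w,\xi)\\ \bigl(\varphi_{\mathrm{FB}}(\mathcal G_i(w,\xi),-\xi_i)\bigr)_{i=1}^{p_2}\end{bmatrix},$$ with componentwise maximum. The function $\Psi_{\mathrm{FB}}(w,\xi):=\frac12\|\mathcal F_{\mathrm{FB}}(w,\xi)\|^2$ is continuously differentiable. Let $$D_N\mathcal F_{\max}(w,\xi):=\begin{bmatrix}\mathcal H'_w(w,\xi)&\mathcal H'_\xi(w,\xi)\\ \mathbb D(I^{\ge}(w,\xi))\mathcal G'_w(w,\xi)&\mathbb D(I^{\ge}(w,\xi))\mathcal G'_\xi(w,\xi)-\mathbb D(I^{<}(w,\xi))\end{bmatrix}.$$ Global nonsmooth Levenberg--Marquardt method. Input: starting point $z^0\in\mathbb R^{p_1}\times\mathbb R^{p_2}$, parameters $\kappa\in(0,1)$, $\tau_{\mathrm{abs}}>0$, $\sigma,\beta\in(0,1)$, $\rho_1,\rho_2>0$, $\gamma_1,\gamma_2>0$. Starting with $k=0$, as long as $\|\mathcal F_{\mathrm{FB}}(z^k)\|\ge\tau_{\mathrm{abs}}$, carry out the following steps and then increase $k$ by one (when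 $\|\mathcal F_{\mathrm{FB}}(z^k)\|<\tau_{\mathrm{abs}}$, stop and return $z^k$): 1. Set $\nu_k:=\min(\gamma_1,\gamma_2\|\mathcal F_{\mathrm{FB}}(z^k)\|)$ and let $d^k$ be the unique solution $d$ of $\bigl(D_N\mathcal F_{\max}(z^k)^\top D_N\mathcal F_{\max}(z^k)+\nu_k\mathbb I^p\bigr)d=-D_N\mathcal F_{\max}(z^k)^\top\mathcal F_{\max}(z^k)$. 2. If $\Psi_{\mathrm{FB}}(z^k+d^k)\le\kappa\Psi_{\mathrm{FB}}(z^k)$, set $z^{k+1}:=z^k+d^k$. 3. Otherwise: if $\Psi_{\mathrm{FB}}'(z^k)d^k>-\rho_1\|\nabla\Psi_{\mathrm{FB}}(z^k)\|\|d^k\|$ or $\|d^k\|<\rho_2$, replace $d^k$ by $-\nabla\Psi_{\mathrm{FB}}(z^k)$. Then set $\alpha_k:=\beta^{i_k}$, where $i_k$ is the smallest positive integer with $\Psi_{\mathrm{FB}}(z^k+\beta^{i_k}d^k)\le\Psi_{\mathrm{FB}}(z^k)+\beta^{i_k}\sigma\Psi_{\mathrm{FB}}'(z^k)d^k$, and set $z^{k+1}:=z^k+\alpha_kd^k$. Convergence $z^k\to\bar z$ is superlinear if $\|z^{k+1}-\bar z\|\in o(\|z^k-\bar z\|)$ and quadratic if $\|z^{k+1}-\bar z\|\in O(\|z^k-\bar z\|^2)$. *)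

(* Defs.v *)
From HB Require Import structures.
From mathcomp Require Import all_boot all_order all_algebra.
From mathcomp Require Import all_classical all_reals all_analysis.

Set Implicit Arguments.
Unset Strict Implicit.
Unset Printing Implicit Defensive.
Import Order.TTheory GRing.Theory Num.Theory.
Import numFieldNormedType.Exports.
Local Open Scope classical_set_scope.
Local Open Scope ring_scope.

Section Calculus.
Context {R : realType}.

(* The library norm `|x| on matrices is the maximum norm; it induces the same
   topology, differentiability and Lipschitz notions as the Euclidean norm. *)
Definition enorm n (x : 'cV[R]_n) : R := Num.sqrt (\sum_i x i 0 ^+ 2).

(* Row i of the Jacobian belongs to the i-th component of f; the library's
   'J f z is for row vectors, and is the transpose of this convention. *)
Definition jac n m (f : 'cV[R]_n -> 'cV[R]_m) (z : 'cV[R]_n) : 'M[R]_(m, n) :=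
  \matrix_(i, j) ('d f z (delta_mx j 0) : 'cV[R]_m) i 0.

Definition grad n (f : 'cV[R]_n -> R^o) (z : 'cV[R]_n) : 'cV[R]_n :=
  \col_j ('d f z (delta_mx j 0) : R).

Definition continuously_differentiable n m (f : 'cV[R]_n -> 'cV[R]_m) : Prop :=
  (forall z, differentiable f z) /\ continuous (jac f).

(* The library notation asks for a Lipschitz bound for pairs of points near any
   pair (x, y); for x != y this already follows from local boundedness. *)
Definition locally_lipschitz_jac n m (f : 'cV[R]_n -> 'cV[R]_m) : Prop :=
  [locally [lipschitz (jac f z) | z in [set: 'cV[R]_n]]].

Definition rows_in m n (I : {set 'I_m}) (A : 'M[R]_(m, n)) : 'M[R]_(#|I|, n) :=
  rowsub (fun k : 'I_#|I| => enum_val k) A.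

Definition superlinear_cvg n (z : nat -> 'cV[R]_n) (l : 'cV[R]_n) : Prop :=
  z @ \oo --> l /\
  (fun k => enorm (z k.+1 - l) : R^o) =o_\oo (fun k => enorm (z k - l) : R^o).

Definition quadratic_cvg n (z : nat -> 'cV[R]_n) (l : 'cV[R]_n) : Prop :=
  z @ \oo --> l /\
  (fun k => enorm (z k.+1 - l) : R^o)
    =O_\oo (fun k => enorm (z k - l) ^+ 2 : R^o).

End Calculus.

Definition phiFB (R : realType) (a b : R) : R :=
  a + b + Num.sqrt (a ^+ 2 + b ^+ 2).

(* A point z = (w, xi) is the block column vector col_mx w xi. *)
Section System.
Context {R : realType} {p1 p2 q1 : nat}.
Variables (H : 'cV[R]_(p1 + p2) -> 'cV[R]_q1)
          (G : 'cV[R]_(p1 + p2) -> 'cV[R]_p2).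
Implicit Types z d : 'cV[R]_(p1 + p2).

Definition xi z : 'cV[R]_p2 := dsubmx z.

Definition Hw z : 'M[R]_(q1, p1) := lsubmx (jac H z).
Definition Hxi z : 'M[R]_(q1, p2) := rsubmx (jac H z).
Definition Gw z : 'M[R]_(p2, p1) := lsubmx (jac G z).
Definition Gxi z : 'M[R]_(p2, p2) := rsubmx (jac G z).

Definition MNLCS z : Prop :=
  [/\ H z = 0, (forall i, G z i 0 <= 0), (forall i, 0 <= xi z i 0)
    & (G z)^T *m xi z = 0].

Definition I0 z : {set 'I_p2} := [set i | G z i 0 == 0].
Definition Ineg z : {set 'I_p2} := [set i | G z i 0 < 0].
Definition Ipos z : {set 'I_p2} := [set i in I0 z | 0 < xi z i 0].
Definition I00 z : {set 'I_p2} := [set i in I0 z | xi z i 0 == 0].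
Definition Ige z : {set 'I_p2} := [set i | - xi z i 0 <= G z i 0].
Definition Ilt z : {set 'I_p2} := [set i | G z i 0 < - xi z i 0].

Definition DI (I : {set 'I_p2}) : 'M[R]_p2 := diag_mx (\row_i (i \in I)%:R).

Definition Fmax z : 'cV[R]_(q1 + p2) :=
  col_mx (H z) (\col_i Num.max (G z i 0) (- xi z i 0)).

Definition FFB z : 'cV[R]_(q1 + p2) :=
  col_mx (H z) (\col_i phiFB (G z i 0) (- xi z i 0)).

Definition PsiFB z : R^o := 2^-1 * enorm (FFB z) ^+ 2.

Definition DNFmax z : 'M[R]_(q1 + p2, p1 + p2) :=
  block_mx (Hw z)                  (Hxi z)
           (DI (Ige z) *m Gw z)    (DI (Ige z) *m Gxi z - DI (Ilt z)).

Definition CQ_mx z (I : {set 'I_p2}) :=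
  let Ic := I00 z :\: I in
  col_mx (row_mx (Hw z) (Hxi z))
 (col_mx (row_mx (rows_in (Ipos z :|: I) (Gw z))
                 (rows_in (Ipos z :|: I) (Gxi z)))
         (row_mx 0 (- rows_in (Ineg z :|: Ic) 1%:M))).

Section Method.
Variables kappa tau_abs sigma beta rho1 rho2 gamma1 gamma2 : R.

Definition nu z : R := Num.min gamma1 (gamma2 * enorm (FFB z)).

Definition LM_system z d : Prop :=
  ((DNFmax z)^T *m DNFmax z + (nu z)%:M) *m d = - ((DNFmax z)^T *m Fmax z).

Definition decrease_test z d : bool := PsiFB (z + d) <= kappa * PsiFB z.

Definition safeguarded_dir z d : 'cV[R]_(p1 + p2) :=
  if (- rho1 * enorm (grad PsiFB z) * enorm d < 'd PsiFB z d)
     || (enorm d < rho2)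
  then - grad PsiFB z else d.

Definition armijo z d (i : nat) : bool :=
  PsiFB (z + beta ^+ i *: d) <= PsiFB z + beta ^+ i * sigma * 'd PsiFB z d.

Definition armijo_exponent z d (i : nat) : Prop :=
  [/\ (0 < i)%N, armijo z d i
    & forall j, (0 < j)%N -> armijo z d j -> (i <= j)%N].

Definition GLM_step z d (znext : 'cV[R]_(p1 + p2)) : Prop :=
  unique (LM_system z) d /\
  if decrease_test z d then znext = z + d
  else exists2 i, armijo_exponent z (safeguarded_dir z d) i
                & znext = z + beta ^+ i *: safeguarded_dir z d.

(* d k is the Levenberg-Marquardt direction of the first step of iteration k,
   before its possible replacement by the negative gradient. The run is
   infinite: the stopping test never triggers. *)
Definition GLM_generated (z d : nat -> 'cV[R]_(p1 + p2)) : Prop :=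
  forall k, tau_abs <= enorm (FFB (z k)) /\ GLM_step (z k) (d k) (z k.+1).

End Method.
End System.

(* Main.v *)
Require Import Defs.
From HB Require Import structures.
From mathcomp Require Import all_boot all_order all_algebra.
From mathcomp Require Import all_classical all_reals all_analysis.
From mathcomp Require Import ring lra.
Set Implicit Arguments.
Unset Strict Implicit.
Unset Printing Implicit Defensive.
Import Order.TTheory GRing.Theory Num.Theory.
Import numFieldNormedType.Exports.
Local Open Scope classical_set_scope.
Local Open Scope ring_scope.

(* Strict differentiability drives the global part. The square of the
   Fischer-Burmeister function has a quadratically accurate first-order
   expansion at every point, so PsiFB expands to first order uniformly in both
   points; its gradient is therefore continuous, and Armijo steps along
   gradient-related directions force stationarity of accumulation points. If
   the decrease test holds infinitely often, the monotone values of PsiFB tend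
   to 0 instead.

   For (c), near zbar each DNFmax z is a small perturbation of one of the
   finitely many matrices CQ_mx zbar I, hence uniformly bounded from below as an
   operator, and Fmax z - DNFmax z (z - zbar) is a Taylor remainder of H and G.
   The regularized normal equations then give
   |z + d - zbar| = o(|z - zbar|), with O(|z - zbar| ^ 2) when the derivatives
   are Lipschitz. As the norm of FFB is equivalent to the distance to zbar, the
   decrease test holds near zbar, so once an iterate is close enough all later
   steps are contracting Levenberg-Marquardt steps. *)

(** * Maximum norm and Euclidean norm *)

Section MatrixNorm.
Context {R : realType}.

Lemma mxDE m n (A B : 'M[R]_(m, n)) i j : (A + B) i j = A i j + B i j.
Proof. by rewrite mxE. Qed.

Lemma mxNE m n (A : 'M[R]_(m, n)) i j : (- A) i j = - A i j.
Proof. by rewrite mxE. Qed.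

Lemma mxBE m n (A B : 'M[R]_(m, n)) i j : (A - B) i j = A i j - B i j.
Proof. by rewrite !mxE. Qed.

Lemma mxZE m n (a : R) (A : 'M[R]_(m, n)) i j : (a *: A) i j = a * A i j.
Proof. by rewrite mxE. Qed.

Lemma diag_row_mulE m n (f : 'I_m -> R) (A : 'M[R]_(m, n)) i j :
  (diag_mx (\row_k f k) *m A) i j = f i * A i j.
Proof. by rewrite mul_diag_mx !mxE. Qed.

Lemma row_mx_rows_in m n1 n2 (I : {set 'I_m}) (A : 'M[R]_(m, n1)) (B : 'M[R]_(m, n2)) :
  row_mx (rows_in I A) (rows_in I B) = rows_in I (row_mx A B).
Proof.
by apply/matrixP => i j; case: (split_ordP j) => {}j ->;
  rewrite ?row_mxEl ?row_mxEr [LHS]mxE [RHS]mxE ?row_mxEl ?row_mxEr.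
Qed.

Lemma mul_rows_in m n (I : {set 'I_m}) (A : 'M[R]_(m, n)) (v : 'cV[R]_n) k :
  (rows_in I A *m v) k 0 = (A *m v) (enum_val k) 0.
Proof. by rewrite !mxE; apply: eq_bigr => j _; rewrite mxE. Qed.

Lemma le_mx_entry m n (A : 'M[R]_(m, n)) i j : `|A i j| <= `|A|.
Proof.
rewrite [leRHS]/Num.norm/= mx_normrE.
exact: (le_bigmax _ (fun ij => `|A ij.1 ij.2|) (i, j)).
Qed.

(** The bound [0 <= c] covers matrices with no entries, whose norm is 0. *)
Lemma mx_norm_le m n (A : 'M[R]_(m, n)) c :
  0 <= c -> (forall i j, `|A i j| <= c) -> `|A| <= c.
Proof.
move=> c0 Ac; rewrite [leLHS]/Num.norm/= mx_normrE.
by apply: bigmax_le => // -[i j] _; exact: Ac.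
Qed.

Lemma mx_norm_mul m n p (A : 'M[R]_(m, n)) (B : 'M[R]_(n, p)) :
  `|A *m B| <= n%:R * `|A| * `|B|.
Proof.
apply: mx_norm_le => [|i k]; first by rewrite !mulr_ge0.
rewrite mxE (le_trans (ler_norm_sum _ _ _))//.
have : \sum_(j < n) `|A i j * B j k| <= \sum_(j < n) (`|A| * `|B|).
  by apply: ler_sum => j _; rewrite normrM ler_pM// le_mx_entry.
by rewrite sumr_const card_ord -[X in _ <= X -> _]mulr_natl mulrA.
Qed.

Lemma mx_norm_trmx m n (A : 'M[R]_(m, n)) : `|A^T| = `|A|.
Proof.
apply/le_anti/andP; split; apply: mx_norm_le => // i j.
  by rewrite mxE le_mx_entry.
by have := le_mx_entry A^T j i; rewrite mxE.
Qed.

Lemma enorm_ge0 n (x : 'cV[R]_n) : 0 <= enorm x.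
Proof. exact: sqrtr_ge0. Qed.

Lemma enorm_sqr n (x : 'cV[R]_n) : enorm x ^+ 2 = \sum_i x i 0 ^+ 2.
Proof. by rewrite sqr_sqrtr// sumr_ge0// => i _; rewrite sqr_ge0. Qed.

Lemma norm_le_enorm n (x : 'cV[R]_n) : `|x| <= enorm x.
Proof.
apply: mx_norm_le => [|i j]; first exact: enorm_ge0.
rewrite (ord1 j) -(ler_pXn2r (_ : 0 < 2)%N) ?nnegrE ?enorm_ge0//.
rewrite enorm_sqr (bigD1 i)//= real_normK ?num_real// lerDl.
by rewrite sumr_ge0// => k _; rewrite sqr_ge0.
Qed.

Lemma enorm_le_norm n (x : 'cV[R]_n) : enorm x <= n%:R * `|x|.
Proof.
rewrite -(ler_pXn2r (_ : 0 < 2)%N) ?nnegrE ?enorm_ge0 ?mulr_ge0//.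
rewrite enorm_sqr (@le_trans _ _ (\sum_(i < n) `|x| ^+ 2))//.
  apply: ler_sum => i _; rewrite -[x i 0 ^+ 2]real_normK ?num_real//.
  by rewrite ler_sqr ?nnegrE// le_mx_entry.
rewrite sumr_const card_ord -[X in X <= _]mulr_natl exprMn ler_wpM2r ?sqr_ge0//.
(* The constant is the dimension instead of its square root: [n <= n ^ 2] for every natural number
   [n]. *)
by rewrite -natrX ler_nat; case: n x => // n _; rewrite leq_pmulr.
Qed.

Lemma enormN n (x : 'cV[R]_n) : enorm (- x) = enorm x.
Proof. by rewrite /enorm; under eq_bigr do rewrite mxE sqrrN. Qed.

Lemma dotmx_ge_sqr n (x : 'cV[R]_n) : `|x| ^+ 2 <= (x^T *m x) 0 0.
Proof.
rewrite (_ : (x^T *m x) 0 0 = enorm x ^+ 2).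
  by rewrite ler_sqr ?nnegrE ?enorm_ge0// norm_le_enorm.
by rewrite enorm_sqr mxE; apply: eq_bigr => i _; rewrite mxE.
Qed.

Lemma norm_dotmx n (a b : 'cV[R]_n) : `|(a^T *m b) 0 0| <= n%:R * `|a| * `|b|.
Proof.
by rewrite (le_trans (le_mx_entry _ _ _))// (le_trans (mx_norm_mul _ _))// mx_norm_trmx.
Qed.

(* A left inverse bounds the operator from below. *)
Lemma row_free_trmx_lower_bound m n (A : 'M[R]_(m, n)) : row_free A^T ->
  exists2 c : R, 0 < c & forall v : 'cV[R]_n, `|v| <= c * `|A *m v|.
Proof.
move=> /row_freeP[B /(congr1 trmx)]; rewrite trmx_mul trmxK trmx1 => BA.
exists (m%:R * `|B^T| + 1) => [|v]; first by rewrite ltr_wpDl// mulr_ge0.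
rewrite -[in leLHS](mul1mx v) -BA -mulmxA (le_trans (mx_norm_mul _ _))//.
by rewrite ler_wpM2r// lerDl.
Qed.

End MatrixNorm.

(** * The Fischer-Burmeister function *)

Section FischerBurmeister.
Context {R : realType}.
Implicit Types a b : R.

(** By symmetry let a be the larger argument and s the root, so that phi = a + (b + s). If a >= 0
    then b + s lies between 0 and 3a; if a < 0 it lies between 0 and -a/2. The first case gives the
    factor 4, the second the factor 1/2. *)
Lemma phiFB_max a b :
  2^-1 * `|Num.max a b| <= `|phiFB a b| <= 4 * `|Num.max a b|.
Proof.
wlog ba : a b / b <= a => [hw|].
  have [/[dup] ba /hw|/ltW/[dup] ab /hw] := leP b a; first by rewrite max_l.
  by rewrite max_l// /phiFB (addrC a) (addrC (a ^+ 2)).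
rewrite max_l// /phiFB; set s := Num.sqrt _.
have s0 : 0 <= s by exact: sqrtr_ge0.
have s2 : s ^+ 2 = a ^+ 2 + b ^+ 2 by rewrite sqr_sqrtr// addr_ge0// sqr_ge0.
have [a0|a0] := leP 0 a.
  have sa : a <= s by rewrite -(ler_pXn2r (_ : 0 < 2)%N)// ?nnegrE// s2 lerDl sqr_ge0.
  have sb : - b <= s.
    have [b0|b0] := leP 0 b; first by lra.
    rewrite -(ler_pXn2r (_ : 0 < 2)%N)// ?nnegrE ?oppr_ge0 ?(ltW b0)//.
    by rewrite s2 sqrrN lerDr sqr_ge0.
  have sab : s <= 3 * a - b.
    by rewrite -(ler_pXn2r (_ : 0 < 2)%N)// ?nnegrE; [rewrite s2; nra|lra].
  by rewrite !ger0_norm; lra.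
have sa : s <= - a - b.
  by rewrite -(ler_pXn2r (_ : 0 < 2)%N)// ?nnegrE; [rewrite s2; nra|lra].
have sb : - b <= s.
  rewrite -(ler_pXn2r (_ : 0 < 2)%N)// ?nnegrE ?s2; [nra|lra].
have sab : s <= - b - a / 2.
  by rewrite -(ler_pXn2r (_ : 0 < 2)%N)// ?nnegrE; [rewrite s2; nra|lra].
by rewrite [`|a|]ltr0_norm// ler0_norm; lra.
Qed.

Lemma phiFB_eq0 a b : (phiFB a b == 0) = (Num.max a b == 0).
Proof.
have /andP[l u] := phiFB_max a b; apply/eqP/eqP => e.
  move: l; rewrite e normr0 pmulr_rle0 ?invr_gt0// => l.
  by apply/eqP; rewrite -normr_le0.
by apply/eqP; rewrite -normr_le0 (le_trans u)// e normr0 mulr0.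
Qed.

(* With the convention x / 0 = 0 the vector (dphiFB a b, dphiFB b a) is a
   subgradient of phiFB, the choice (1, 1) being made at the origin. *)
Definition dphiFB a b : R := 1 + a / Num.sqrt (a ^+ 2 + b ^+ 2).

Lemma dphiFB_le2 a b : `|dphiFB a b| <= 2.
Proof.
rewrite /dphiFB; set s := Num.sqrt _.
have s0 : 0 <= s by exact: sqrtr_ge0.
have /= as_ : `|a| <= s.
  rewrite -(ler_pXn2r (_ : 0 < 2)%N)// ?nnegrE// real_normK ?num_real//.
  by rewrite sqr_sqrtr ?addr_ge0 ?sqr_ge0// lerDl sqr_ge0.
rewrite (le_trans (ler_normD _ _))// normr1 normrM normfV (ger0_norm s0).
have [->|sn0] := eqVneq s 0; first by rewrite invr0 mulr0 addr0; lra.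
have : `|a| / s <= 1 by rewrite ler_pdivrMr ?mul1r// lt0r sn0.
by lra.
Qed.

(* The square of phiFB has a globally Lipschitz gradient, also at the origin:
   with x = (a, b), y = (a', b'), the term phi(x) (|y| - |x| - <x, y - x> / |x|)
   equals phi(x) / |x| times |x| |y| - <x, y> <= |x - y| ^ 2 / 2, and
   phi(x) <= 3 |x|. *)
Lemma phiFB_sqr_expansion a b a' b' :
  `|phiFB a' b' ^+ 2 - phiFB a b ^+ 2
    - 2 * phiFB a b * (dphiFB a b * (a' - a) + dphiFB b a * (b' - b))|
  <= 16 * ((a' - a) ^+ 2 + (b' - b) ^+ 2).
Proof.
rewrite /dphiFB (addrC (b ^+ 2)) /phiFB; set s := Num.sqrt (a ^+ 2 + _).
set t := Num.sqrt _.
have s0 : 0 <= s by exact: sqrtr_ge0.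
have t0 : 0 <= t by exact: sqrtr_ge0.
have s2 : s ^+ 2 = a ^+ 2 + b ^+ 2 by rewrite sqr_sqrtr// addr_ge0// sqr_ge0.
have t2 : t ^+ 2 = a' ^+ 2 + b' ^+ 2 by rewrite sqr_sqrtr// addr_ge0// sqr_ge0.
set D := (a' - a) ^+ 2 + _.
have De : D = s ^+ 2 + t ^+ 2 - 2 * (a * a' + b * b') by rewrite s2 t2 /D; ring.
have D0 : 0 <= D by rewrite addr_ge0// sqr_ge0.
have ps : a * a' + b * b' <= s * t.
  rewrite (le_trans (ler_norm _))//.
  rewrite -(ler_pXn2r (_ : 0 < 2)%N)// ?nnegrE ?mulr_ge0//.
  rewrite real_normK ?num_real// exprMn s2 t2 -subr_ge0.
  by rewrite (_ : _ - _ = (a * b' - b * a') ^+ 2) ?sqr_ge0//; ring.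
(* Cauchy-Schwarz on the left; on the right, D equals (s - t)^2 plus twice this term. *)
have st : 0 <= s * t - (a * a' + b * b') <= D / 2.
  by rewrite subr_ge0 ps/=; have := sqr_ge0 (s - t); rewrite sqrrB; lra.
(* The square of a sum of three terms is at most three times the sum of their squares; the first two
   squares add up to D and the third is at most D. *)
have e1 : (a' + b' + t - (a + b + s)) ^+ 2 <= 6 * D.
  have ts : (t - s) ^+ 2 <= D by rewrite sqrrB; lra.
  have := sqr_ge0 ((a' - a) - (b' - b)); have := sqr_ge0 ((a' - a) - (t - s)).
  have := sqr_ge0 ((b' - b) - (t - s)).
  rewrite (_ : a' + b' + t - (a + b + s) = (a' - a) + (b' - b) + (t - s)); last by ring.
  move: ts D0; rewrite /D; set x := a' - a; set y := b' - b; set w := t - s.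
  by rewrite !sqrrB !sqrrD; lra.
have absa : `|a + b| <= 2 * s.
  rewrite -(ler_pXn2r (_ : 0 < 2)%N)// ?nnegrE ?mulr_ge0//.
  rewrite real_normK ?num_real// exprMn s2.
  have := sqr_ge0 (a - b); have := sqr_ge0 a; have := sqr_ge0 b.
  by rewrite sqrrB sqrrD; lra.
(* At the origin [phiFB] vanishes, so the linear term drops out and [e1] alone suffices. *)
have [sz|sn0] := eqVneq s 0.
  have [a0 b0] : a = 0 /\ b = 0.
    move: s2; rewrite sz expr0n/= => /esym/eqP.
    by rewrite paddr_eq0 ?sqr_ge0// !sqrf_eq0 => /andP[/eqP-> /eqP->].
  move: e1; rewrite /D sz a0 b0 !(addr0, subr0, mulr0, mul0r, expr0n)/= => e1.
  by rewrite ger0_norm ?sqr_ge0//; move: D0; rewrite /D a0 b0 !subr0; lra.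
have sp : 0 < s by rewrite lt0r sn0.
(* The last summand is zero by [s2]; with it included, the identity is purely algebraic and holds
   for every nonzero s. *)
have -> : (a' + b' + t) ^+ 2 - (a + b + s) ^+ 2 -
   2 * (a + b + s) * ((1 + a / s) * (a' - a) + (1 + b / s) * (b' - b))
   = (a' + b' + t - (a + b + s)) ^+ 2
     + 2 * ((a + b + s) / s) * (s * t - (a * a' + b * b'))
     + 2 * ((a + b + s) / s) * (a ^+ 2 + b ^+ 2 - s ^+ 2) by field.
rewrite -s2 subrr mulr0 addr0.
have : `|(a + b + s) / s| <= 3.
  by rewrite normrM normfV (ger0_norm s0) ler_pdivrMr// (le_trans (ler_normD _ _))//
     (ger0_norm s0); lra.
set q := (a + b + s) / s; set w := s * t - _ in st *; set u := (_ ^+ 2) in e1 *.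
have u0 : 0 <= u by exact: sqr_ge0.
move: st => /andP[w0 wD] q3.
rewrite (le_trans (ler_normD _ _))// (ger0_norm u0) normrM (ger0_norm w0) normrM.
rewrite (ger0_norm (_ : 0 <= 2))//.
have : `|q| * w <= 3 * (D / 2) by rewrite ler_pM.
by lra.
Qed.

End FischerBurmeister.

(** * Neighbourhoods of diagonal pairs, and cluster points of sequences *)

Section Nearness.
Context {R : realType}.

Lemma near_pairP n (x0 : 'cV[R]_n) (P : 'cV[R]_n * 'cV[R]_n -> Prop) :
  (\forall u \near (x0, x0), P u) <->
  exists2 r : R, 0 < r & forall x y, `|x - x0| < r -> `|y - x0| < r -> P (x, y).
Proof.
split=> [/nbhs_ballP[r /= r0 hr]|[r r0 hr]].
  by exists r => // x y xr yr; apply: hr; split=> /=;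
    rewrite -ball_normE/= distrC.
apply/nbhs_ballP; exists r => //= -[x y] [/=].
by rewrite -!ball_normE/= => xr yr; apply: hr; rewrite distrC.
Qed.

Lemma near_fst n (x0 : 'cV[R]_n) (P : 'cV[R]_n -> Prop) :
  (\forall x \near x0, P x) -> \forall u \near (x0, x0), P u.1.
Proof. by move=> hP; apply: (@cvg_fst _ _ (nbhs x0) (nbhs x0)). Qed.

Lemma near_pair_left n (x0 : 'cV[R]_n) (P : 'cV[R]_n * 'cV[R]_n -> Prop) :
  (\forall u \near (x0, x0), P u) -> \forall x \near x0, P (x, x0).
Proof.
move=> /near_pairP[r r0 hr]; apply/nbhs_ballP; exists r => // x.
rewrite -ball_normE/= distrC => xr; apply: hr => //.
by rewrite subrr normr0.
Qed.

Lemma near_norm_le n (W : normedModType R) (g : 'cV[R]_n -> W) (x0 : 'cV[R]_n) :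
  {for x0, continuous g} -> \forall x \near x0, `|g x| <= `|g x0| + 1.
Proof.
move=> /cvgr_dist_le/(_ 1 ltr01); apply: filterS => x xx.
by rewrite -lerBlDl (le_trans (lerB_dist _ _))// distrC.
Qed.

Lemma near_norm_half n (W : normedModType R) (g : 'cV[R]_n -> W) (x : 'cV[R]_n) :
  {for x, continuous g} -> 0 < `|g x| -> \forall y \near x, `|g x| / 2 <= `|g y|.
Proof.
move=> gc gx; have g2 : 0 < `|g x| / 2 by rewrite divr_gt0.
have /cvgr_dist_le/(_ _ g2) := gc.
apply: filterS => y xy; have := le_trans (lerB_dist _ _) xy.
by move: (`|g x|) (`|g y|) => a b; lra.
Qed.

Lemma norm_segment n (x0 x y : 'cV[R]_n) (t r : R) : 0 <= t <= 1 ->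
  `|x - x0| < r -> `|y - x0| < r -> `|t *: (y - x) + x - x0| < r.
Proof.
move=> /andP[t0 t1] xr yr.
rewrite (_ : _ - x0 = t *: (y - x0) + (1 - t) *: (x - x0)); last first.
  by rewrite scalerBl scale1r !scalerBr !opprB; apply/colP => i; rewrite !mxE; ring.
rewrite (le_lt_trans (ler_normD _ _))// !normrZ (ger0_norm t0).
rewrite ger0_norm ?subr_ge0//.
(* The strict inequality is carried by the term of weight t, so t = 0 is treated apart. *)
have [->|tn0] := eqVneq t 0; first by rewrite mul0r add0r subr0 mul1r.
rewrite (_ : r = t * r + (1 - t) * r); last by ring.
rewrite ltr_leD ?ltr_pM2l// ?lt0r ?tn0// ler_wpM2l ?subr_ge0// ltW//.
Qed.

Lemma cluster_frequently n (u : nat -> 'cV[R]_n) (l : 'cV[R]_n) (P : 'cV[R]_n -> Prop) N :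
  cluster (u @ \oo) l -> (\forall x \near l, P x) ->
  exists2 k, (N <= k)%N & P (u k).
Proof.
move=> /(_ [set u k | k in [set k | (N <= k)%N]] P) + Pl => /(_ _ Pl)[].
  by exists N => // k /= Nk; exists k.
by move=> x [[k /= Nk <-] Pk]; exists k.
Qed.

Lemma infinite_set_frequently (A : set nat) N : infinite_set A ->
  exists2 k, (N <= k)%N & A k.
Proof.
move=> infA; apply: contrapT => nA; apply: infA.
apply: (@sub_finite_set _ _ `I_N); last exact: finite_II.
move=> k Ak /=; rewrite ltnNge; apply/negP => Nk; apply: nA.
by exists k.
Qed.

End Nearness.

(** * Jacobians and strict differentiability *)

Section Jacobian.
Context {R : realType}.

Lemma diff_jac n m (f : 'cV[R]_n -> 'cV[R]_m) z v : 'd f z v = jac f z *m v.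
Proof.
rewrite {1}[v]matrix_sum_delta linear_sum; apply/colP => i.
rewrite summxE mxE; apply: eq_bigr => j _.
by rewrite big_ord1 linearZ !mxE mulrC.
Qed.

Lemma diff_grad n (f : 'cV[R]_n -> R^o) z v :
  'd f z v = ((grad f z)^T *m v) 0 0.
Proof.
rewrite {1}[v]matrix_sum_delta linear_sum mxE; apply: eq_bigr => j _.
by rewrite big_ord1 linearZ !mxE mulrC.
Qed.

Global Instance is_diff_coord m n (M : 'M[R]_(m, n)) i j :
  is_diff M (fun N : 'M[R]_(m, n) => N i j : R^o) (fun N => N i j).
Proof.
have lin : linear (fun N : 'M[R]_(m, n) => N i j : R^o).
  by move=> a A B; rewrite !mxE.
pose L := GRing.isLinear.Build _ _ _ _ _ lin.
pose l : {linear 'M[R]_(m, n) -> R^o} := HB.pack (fun N : 'M[R]_(m, n) => N i j : R^o) L.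
apply: DiffDef; first exact: differentiable_coord.
by rewrite (_ : (fun _ => _) = l)// diff_lin//; exact: coord_continuous.
Qed.

(** The scalar mean value theorem along the segment, one component at a time: the intermediate
    parameter may depend on [i]. *)
Lemma mean_value_jac n m (f : 'cV[R]_n -> 'cV[R]_m) x y i :
  (forall z, differentiable f z) ->
  exists2 t : R, 0 <= t <= 1 &
    f y i 0 - f x i 0 = (jac f (t *: (y - x) + x) *m (y - x)) i 0.
Proof.
move=> df; set h := y - x.
pose g (s : R) : R := f (s *: h + x) i 0.
have dg (s : R) : is_derive s 1 g ((jac f (s *: h + x) *m h) i 0).
  have da : is_diff s (fun s : R => s *: h + x : 'cV[R]_n) (fun s => s *: h).
    have -> : (fun s : R => s *: h + x : 'cV[R]_n) = ( *:%R^~ h) + cst x by [].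
    by apply: is_diff_eq; rewrite addr0.
  have dc : is_diff s (fun s : R => f (s *: h + x)) ('d f (s *: h + x) \o ( *:%R^~ h)).
    apply: (@is_diff_comp _ _ _ _ (fun s : R => s *: h + x) _ f _ s da).
    by apply: DiffDef.
  have dd : is_diff s (g : R -> R^o) (fun s' => ('d f (s *: h + x) (s' *: h)) i 0).
    exact: (@is_diff_comp _ _ _ _ (fun s : R => f (s *: h + x)) _
      (fun N : 'cV[R]_m => N i 0 : R^o) _ s dc).
  have dfg : differentiable (g : R -> R^o) s by case: dd.
  apply: DeriveDef; first exact: diff_derivable.
  by rewrite deriveE// diff_val scale1r diff_jac.
have [|t] := @MVT_segment _ g (fun s => (jac f (s *: h + x) *m h) i 0) 0 1 ler01.
  apply: continuous_subspaceT => s; apply: differentiable_continuous.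
  by apply/derivable1_diffP; case: (dg s).
rewrite in_itv/= => t01 ge; exists t => //; move: ge.
by rewrite /g subr0 mulr1 scale1r scale0r add0r /h subrK.
Qed.

(** By the mean value theorem each component of the remainder is an entry of a difference of
    Jacobians applied to y - x; the factor n comes from the maximum norm of a product. *)
Lemma jac_remainder n m (f : 'cV[R]_n -> 'cV[R]_m) x y c :
  (forall z, differentiable f z) -> 0 <= c ->
  (forall t : R, 0 <= t <= 1 -> `|jac f (t *: (y - x) + x) - jac f x| <= c) ->
  `|f y - f x - jac f x *m (y - x)| <= n%:R * c * `|y - x|.
Proof.
move=> df c0 hc; apply: mx_norm_le => [|i j]; first by rewrite !mulr_ge0.
have [t t01 ft] := mean_value_jac x y i df.
rewrite (ord1 j) !mxBE ft -mxBE -mulmxBl.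
rewrite (le_trans (le_mx_entry _ _ _))// (le_trans (mx_norm_mul _ _))//.
by rewrite ler_wpM2r// ler_wpM2l// hc.
Qed.

Lemma near_jac_remainder n m (f : 'cV[R]_n -> 'cV[R]_m) (x0 : 'cV[R]_n) e :
  continuously_differentiable f -> 0 < e ->
  \forall u \near (x0, x0),
    `|f u.2 - f u.1 - jac f u.1 *m (u.2 - u.1)| <= e * `|u.2 - u.1|.
Proof.
(* Two Jacobians within c of [jac f x0] differ by at most 2c, and n * 2c <= e; the successor avoids
   division by 0 for n = 0. *)
move=> [df cf] e0; pose c := e / (n.+1%:R * 2).
have c0 : 0 < c by rewrite divr_gt0// mulr_gt0.
have /cvgr_dist_le/(_ c c0)/nbhs_ballP[r /= r0 hr] := cf x0.
apply/near_pairP; exists r => // x y xr yr /=.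
apply: (@le_trans _ _ (n%:R * (c + c) * `|y - x|)); last first.
  have nz : n.+1%:R != 0 :> R by rewrite pnatr_eq0.
  have -> : c + c = e / n.+1%:R by move: nz; rewrite /c; set N := n.+1%:R => nz; field.
  rewrite ler_wpM2r// mulrCA ler_piMr ?(ltW e0)// ler_pdivrMr// mul1r.
  by rewrite ler_nat.
apply: jac_remainder => //; first by rewrite addr_ge0// ltW.
move=> t t01.
rewrite (le_trans (ler_distD (jac f x0) _ _))// [X in X + _]distrC.
rewrite lerD// hr// -ball_normE/= distrC//.
exact: norm_segment.
Qed.

Lemma near_jac_remainder_lipschitz n m (f : 'cV[R]_n -> 'cV[R]_m)
    (x0 : 'cV[R]_n) :
  (forall z, differentiable f z) -> locally_lipschitz_jac f ->
  exists2 c : R, 0 < c & \forall u \near (x0, x0),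
    `|f u.2 - f u.1 - jac f u.1 *m (u.2 - u.1)| <= c * `|u.2 - u.1| ^+ 2.
Proof.
move=> df lf.
(* At a diagonal point the local condition bounds the difference of Jacobians for any two points of
   a ball around [x0]. *)
have := lf (x0, x0) (conj I I); rewrite /lipschitz_on.
have -> : [set: 'cV[R]_n] `*` [set: 'cV[R]_n] = setT by rewrite setXTT.
move=> /pinfty_ex_gt0[c c0]; rewrite /dominated_by /within/= => /near_pairP[r r0 hr].
exists (n%:R * c + 1); first by rewrite ltr_wpDl// mulr_ge0// ltW.
apply/near_pairP; exists r => // x y xr yr /=.
apply: (@le_trans _ _ (n%:R * (c * `|y - x|) * `|y - x|)).
  apply: jac_remainder => //; first by rewrite mulr_ge0// ltW.
  move=> t t01; have := hr _ _ (norm_segment t01 xr yr) xr I.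
  rewrite /= => /le_trans; apply; rewrite /self_sub/= addrK normrZ ler_wpM2l ?(ltW c0)//.
  by move/andP: t01 => [t0 t1]; rewrite ger0_norm// ler_piMl.
by rewrite mulrA -mulrA -expr2 ler_wpM2r ?sqr_ge0// lerDl.
Qed.

(* Uniformity in both points makes g continuous at x0, so continuous
   differentiability never has to be read off a formula for the gradient. *)
Definition strictly_differentiable n (f : 'cV[R]_n -> R^o)
    (g : 'cV[R]_n -> 'cV[R]_n) (x0 : 'cV[R]_n) :=
  forall e : R, 0 < e -> \forall u \near (x0, x0),
    `|f u.2 - f u.1 - ((g u.1)^T *m (u.2 - u.1)) 0 0| <= e * `|u.2 - u.1|.

(** Fixing the first point at [x0] leaves the ordinary first-order expansion, and the differential
    is unique. *)
Lemma strictly_differentiable_diff n (f : 'cV[R]_n -> R^o) g (x0 : 'cV[R]_n) :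
  strictly_differentiable f g x0 -> differentiable f x0 /\ grad f x0 = g x0.
Proof.
move=> sf.
have lin : linear (fun v : 'cV[R]_n => ((g x0)^T *m v) 0 0 : R^o).
  by move=> a A B; rewrite linearD linearZ mxE [in LHS]mxE.
pose L := GRing.isLinear.Build _ _ _ _ _ lin.
pose l : {linear 'cV[R]_n -> R^o} := HB.pack (fun v : 'cV[R]_n => ((g x0)^T *m v) 0 0 : R^o) L.
have lc : continuous l.
  apply/linear_bounded_continuous/linear_boundedP.
  exists (n%:R * `|(g x0)^T|); split; first exact: num_real.
  move=> c hc v; rewrite (le_trans (le_mx_entry ((g x0)^T *m v) 0 0))//.
  by rewrite (le_trans (mx_norm_mul _ _))// ler_wpM2r// ltW.
have fl : f \o shift x0 = cst (f x0) + (l : 'cV[R]_n -> R^o) +o_ (0 : 'cV[R]_n) id.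
  apply/eqaddoP => e e0; have /near_pairP[r r0 hr] := sf e e0.
  have : \forall h \near (0 : 'cV[R]_n), `|f (h + x0) - (f x0 + l h)| <= e * `|h|.
    apply/nbhs_norm0P; exists r => //= h /= hr'.
    have := hr x0 (h + x0); rewrite /= subrr normr0 addrK => /(_ r0 hr').
    by rewrite opprD addrA.
  by apply.
have dl := diff_unique lc fl.
split.
  by apply/diff_locallyP; rewrite dl.
apply/colP => j; rewrite mxE dl /=.
rewrite mxE (bigD1 j)//= big1 => [|k kj]; rewrite !mxE ?eqxx ?mulr1 ?addr0//.
by rewrite (negPf kj) mulr0.
Qed.

(** Expanding f from x0 to z, from z to z + h and from x0 to z + h, with h along the j-th axis, and
    cancelling the values of f leaves the j-th entry of g z - g x0 times the length of h. *)
Lemma strictly_differentiable_continuous_grad n (f : 'cV[R]_n -> R^o) g (x0 : 'cV[R]_n) :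
  strictly_differentiable f g x0 -> {for x0, continuous g}.
Proof.
move=> sf; apply/(@cvgrPdist_le _ _ _ (nbhs x0)) => e e0.
(* The three increments have lengths at most r, r/2 and r/2, so the errors total at most (e/4) * 2r,
   which is e times the length r/2 of the axis step. *)
have e4 : 0 < e / 4 by rewrite divr_gt0.
have /near_pairP[r r0 hr] := sf _ e4.
have r2 : 0 < r / 2 by rewrite divr_gt0.
apply/nbhs_ballP; exists (r / 2) => // z; rewrite -ball_normE/= distrC => zr.
rewrite distrC; apply: mx_norm_le => [|j k]; first exact: ltW.
rewrite (ord1 k) mxBE.
pose h : 'cV[R]_n := (r / 2) *: delta_mx j 0.
have hn : `|h| <= r / 2.
  apply: mx_norm_le => [|a b]; first exact: ltW.
  rewrite !mxE normrM (gtr0_norm r2) ler_piMr ?(ltW r2)//.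
  by case: (_ && _); rewrite ?normr0 ?normr1.
have x0r : `|x0 - x0| < r by rewrite subrr normr0.
have zr' : `|z - x0| < r by lra.
have zhn : `|z + h - x0| <= `|z - x0| + `|h| by rewrite addrAC ler_normD.
have zhr : `|z + h - x0| < r by lra.
have := hr _ _ x0r zhr; have := hr _ _ x0r zr'; have := hr _ _ zr' zhr => /=.
have gh (w : 'cV[R]_n) : (w^T *m h) 0 0 = w j 0 * (r / 2).
  rewrite -scalemxAr mxE (mxE _ _ 0 0) (bigD1 j)//= big1 => [|i ij]; rewrite !mxE.
    by rewrite !eqxx mulr1 addr0 mulrC.
  by rewrite (negPf ij) mulr0.
rewrite [z + h - z]addrAC subrr add0r gh.
have -> : ((g x0)^T *m (z + h - x0)) 0 0 =
    ((g x0)^T *m (z - x0)) 0 0 + g x0 j 0 * (r / 2).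
  by rewrite [z + h - x0]addrAC mulmxDr mxE gh.
set p := _ *m (z - x0); move: (p 0 0) => {}p.
move: zhn zr hn.
move: (g z j 0) (g x0 j 0) (f (z + h)) (f z) (f x0) => a b fzh fz fx.
move: (`|z + h - x0|) (`|z - x0|) (`|h|) => A B C AB Br Cr.
rewrite !ler_norml => /andP[h1 h2] /andP[h3 h4] /andP[h5 h6].
have k1 : e / 4 * A <= e / 4 * r by rewrite ler_pM2l//; lra.
have k2 : e / 4 * B <= e / 4 * (r / 2) by rewrite ler_pM2l//; lra.
have k3 : e / 4 * C <= e / 4 * (r / 2) by rewrite ler_pM2l.
by apply/andP; split; rewrite -(ler_pM2r r2); lra.
Qed.

End Jacobian.

(** * The merit function *)

Section Merit.
Context {R : realType}.

(** The increment of f is its Taylor remainder, of constant 1 near x0, plus the locally bounded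
    Jacobian applied to y - x. *)
Lemma near_bounds n m (f : 'cV[R]_n -> 'cV[R]_m) (x0 : 'cV[R]_n) :
  continuously_differentiable f ->
  exists2 M : R, 0 < M & \forall u \near (x0, x0),
    `|f u.1| <= M /\ `|f u.2 - f u.1| <= M * `|u.2 - u.1|.
Proof.
move=> [df cf]; have fc := differentiable_continuous (df x0).
have jb := near_norm_le (cf x0); have fb := near_norm_le fc.
exists (`|f x0| + 1 + (1 + n%:R * (`|jac f x0| + 1))).
  by rewrite ltr_wpDr ?ltr_wpDl// addr_ge0// mulr_ge0// addr_ge0.
have := near_jac_remainder x0 (conj df cf) ltr01.
have := near_fst jb; have := near_fst fb.
apply: filterS3 => -[x y]/= fx jx r; split.
  by rewrite (le_trans fx)// lerDl addr_ge0// mulr_ge0// addr_ge0.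
rewrite (_ : f y - f x = (f y - f x - jac f x *m (y - x)) + jac f x *m (y - x)).
  rewrite (le_trans (ler_normD _ _))// mulrDl ler_wpDl ?mulr_ge0 ?addr_ge0//.
  rewrite mulrDl lerD// (le_trans (mx_norm_mul _ _))// ler_wpM2r// ler_wpM2l//.
by rewrite subrK.
Qed.

Context {p1 p2 q1 : nat}.
Variables (H : 'cV[R]_(p1 + p2) -> 'cV[R]_q1)
          (G : 'cV[R]_(p1 + p2) -> 'cV[R]_p2).
Hypotheses (HC1 : continuously_differentiable H)
           (GC1 : continuously_differentiable G).
Implicit Types z d : 'cV[R]_(p1 + p2).

Lemma xiE z i : xi z i 0 = z (rshift p1 i) 0.
Proof. by rewrite mxE. Qed.

(* A generalized Jacobian of FFB. *)
Definition VFB z : 'M[R]_(q1 + p2, p1 + p2) :=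
  col_mx (jac H z)
    (diag_mx (\row_i dphiFB (G z i 0) (- xi z i 0)) *m jac G z -
     row_mx 0 (diag_mx (\row_i dphiFB (- xi z i 0) (G z i 0)))).

Lemma VFB_mul_l z (v : 'cV[R]_(p1 + p2)) i : (VFB z *m v) (lshift p2 i) 0 = (jac H z *m v) i 0.
Proof. by rewrite mul_col_mx col_mxEu. Qed.

Lemma VFB_mul_r z (v : 'cV[R]_(p1 + p2)) i : (VFB z *m v) (rshift q1 i) 0 =
  dphiFB (G z i 0) (- xi z i 0) * (jac G z *m v) i 0
  - dphiFB (- xi z i 0) (G z i 0) * xi v i 0.
Proof.
rewrite mul_col_mx col_mxEd mulmxBl mxBE -mulmxA diag_row_mulE; congr (_ - _).
by rewrite -{1}[v]vsubmxK mul_row_col mul0mx add0r diag_row_mulE.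
Qed.

Lemma FFB_l z i : FFB H G z (lshift p2 i) 0 = H z i 0.
Proof. by rewrite col_mxEu. Qed.

Lemma FFB_r z i : FFB H G z (rshift q1 i) 0 = phiFB (G z i 0) (- xi z i 0).
Proof. by rewrite col_mxEd mxE. Qed.

Lemma PsiFBE z : PsiFB H G z = 2^-1 * \sum_i FFB H G z i 0 ^+ 2.
Proof. by rewrite /PsiFB enorm_sqr. Qed.

(** The estimate is made for half the square of each entry of [FFB]: entries of H by expanding the
    square, the others by [phiFB_sqr_expansion]; summing over the entries gives [PsiFB]. *)
Lemma strictly_differentiable_PsiFB z :
  strictly_differentiable (PsiFB H G) (fun y => (VFB y)^T *m FFB H G y) z.
Proof.
move=> e e0.
have [MH MH0 bH] := near_bounds z HC1.
have [MG MG0 bG] := near_bounds z GC1.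
pose M := MH + MG + (`|z| + 1).
have z10 : 0 < `|z| + 1 by rewrite ltr_wpDl.
have M0 : 0 < M by rewrite /M; lra.
(* A Fischer-Burmeister entry contributes 8 (M^2 + 1) from the expansion of the square and 8M from
   linearizing G; an entry of H contributes less. *)
pose K := 8 * (M ^+ 2 + M + 1).
have K0 : 0 < K by rewrite mulr_gt0//; have := sqr_ge0 M; lra.
pose e' := e / ((q1 + p2)%:R * K + 1).
have D0 : 0 < (q1 + p2)%:R * K + 1 by rewrite ltr_wpDl// mulr_ge0// ltW.
have e'0 : 0 < e' by rewrite divr_gt0.
have bz : \forall u \near (z, z), `|u.1| <= M /\ `|u.2 - u.1| <= e'.
  (* Radius 1 bounds |x| by |z| + 1; radius e'/2 gives |h| <= e', which turns |h|^2 into at most e'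
     |h|. *)
  apply/near_pairP; exists (Num.min 1 (e' / 2)); first by rewrite lt_min ltr01 divr_gt0.
  move=> x y; rewrite !lt_min => /andP[x1 xe] /andP[y1 ye] /=; split.
    rewrite -[x](subrK z) (le_trans (ler_normD _ _))// /M.
    by rewrite ler_wpDl ?addr_ge0 ?(ltW MH0) ?(ltW MG0)// addrC lerD2l ltW.
  by rewrite (le_trans (ler_distD z _ _))// [`|z - x|]distrC; lra.
have rH := near_jac_remainder z HC1 e'0.
have rG := near_jac_remainder z GC1 e'0.
apply: filterS (filterI (filterI bH bG) (filterI bz (filterI rH rG)))
  => -[x y] /= [[[Hx HL] [Gx GL]] [[xM he] [{}rH {}rG]]].
set h := y - x in HL GL he rH rG *.
have MHM : MH <= M by rewrite /M -addrA lerDl addr_ge0// ltW.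
have MGM : MG <= M by rewrite /M addrAC lerDr addr_ge0// ltW.
have h0 : 0 <= `|h| by [].
have term i : `|2^-1 * FFB H G y i 0 ^+ 2 - 2^-1 * FFB H G x i 0 ^+ 2
     - FFB H G x i 0 * (VFB x *m h) i 0| <= K * e' * `|h|.
  case: (split_ordP i) => {}i ->.
    rewrite !FFB_l VFB_mul_l.
    have ax : `|H x i 0| <= M by rewrite (le_trans (le_mx_entry _ _ _))// (le_trans Hx).
    have aL : `|H y i 0 - H x i 0| <= M * `|h|.
      rewrite -mxBE (le_trans (le_mx_entry _ _ _))// (le_trans HL)//.
      by rewrite ler_wpM2r.
    have ar : `|H y i 0 - H x i 0 - (jac H x *m h) i 0| <= e' * `|h|.
      by rewrite -!mxBE (le_trans (le_mx_entry _ _ _)).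
    move: (H x i 0) (H y i 0) ((jac H x *m h) i 0) ax aL ar => a b c ax aL ar.
    rewrite (_ : _ - _ = 2^-1 * (b - a) ^+ 2 + a * (b - a - c)); last by field.
    have t1 : `|2^-1 * (b - a) ^+ 2| <= 2^-1 * (M ^+ 2 * (e' * `|h|)).
      rewrite normrM ger0_norm ?invr_ge0// ler_wpM2l ?invr_ge0// normrX.
      rewrite (@le_trans _ _ ((M * `|h|) ^+ 2))//.
        by rewrite ler_sqr ?nnegrE ?mulr_ge0// ltW.
      by rewrite exprMn ler_wpM2l ?sqr_ge0// expr2 ler_wpM2r.
    have t2 : `|a * (b - a - c)| <= M * (e' * `|h|) by rewrite normrM ler_pM.
    rewrite (le_trans (ler_normD _ _))// (le_trans (lerD t1 t2))// /K.
    have := sqr_ge0 M; move: M0 (mulr_ge0 (ltW e'0) h0); rewrite -mulrA.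
    move: (M ^+ 2) (e' * _) => M2 w M0 w0 M20.
    have := mulr_ge0 (ltW M0) w0; have := mulr_ge0 M20 w0.
    by lra.
  rewrite !FFB_r VFB_mul_r.
  have ax : `|G x i 0| <= M by rewrite (le_trans (le_mx_entry _ _ _))// (le_trans Gx).
  have xx : `|- xi x i 0| <= M by rewrite normrN xiE (le_trans (le_mx_entry _ _ _)).
  have xL : `|- xi y i 0 - - xi x i 0| <= `|h|.
    by rewrite -opprD normrN !xiE -mxBE le_mx_entry.
  have -> : xi h i 0 = - (- xi y i 0 - - xi x i 0).
    by rewrite -opprD opprK !xiE mxBE.
  have aL : `|G y i 0 - G x i 0| <= M * `|h|.
    rewrite -mxBE (le_trans (le_mx_entry _ _ _))// (le_trans GL)//.
    by rewrite ler_wpM2r.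
  have ar : `|G y i 0 - G x i 0 - (jac G x *m h) i 0| <= e' * `|h|.
    by rewrite -!mxBE (le_trans (le_mx_entry _ _ _)).
  move: (G x i 0) (G y i 0) (- xi x i 0) (- xi y i 0) ((jac G x *m h) i 0) ax xx xL aL ar.
  move=> a a' b b' c ax bx bL aL ar.
  have ex := phiFB_sqr_expansion a b a' b'.
  have d2 := dphiFB_le2 a b.
  have ph : `|phiFB a b| <= 4 * M.
    have /andP[_ /le_trans->//] := phiFB_max a b.
    by rewrite ler_wpM2l//; case: (leP a b).
  move: (dphiFB a b) (dphiFB b a) (phiFB a b) (phiFB a' b') ex d2 ph => da db f f' ex d2 ph.
  (* [E] is the error of expanding the square of [phiFB]; what remains is the error of linearizing
     G_i, since the increment of xi_i is already linear. *)
  set E := (X in `|X| <= _) in ex.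
  rewrite (_ : _ - _ = 2^-1 * E + f * da * (a' - a - c)); last by rewrite /E; field.
  have t2 : `|f * da * (a' - a - c)| <= 4 * M * 2 * (e' * `|h|).
    by rewrite !normrM ler_pM ?mulr_ge0// ler_pM.
  have b2 : (b' - b) ^+ 2 <= e' * `|h|.
    rewrite -real_normK ?num_real// (@le_trans _ _ (`|h| ^+ 2))//.
      by rewrite ler_sqr ?nnegrE.
    by rewrite expr2 ler_wpM2r.
  have a2 : (a' - a) ^+ 2 <= M ^+ 2 * (e' * `|h|).
    rewrite -real_normK ?num_real// (@le_trans _ _ ((M * `|h|) ^+ 2))//.
      by rewrite ler_sqr ?nnegrE// mulr_ge0// ltW.
    by rewrite exprMn ler_wpM2l ?sqr_ge0// expr2 ler_wpM2r.
  rewrite (le_trans (ler_normD _ _))// normrM ger0_norm ?invr_ge0//.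
  move: (`|E|) (`|_ * _|) ex t2 a2 b2 => E' t ex t2; rewrite /K -mulrA.
  move: (M ^+ 2) (e' * _) ((a' - a) ^+ 2) ((b' - b) ^+ 2) ex t2 => M2 w A2 B2 ex t2 a2 b2.
  by lra.
rewrite !PsiFBE -mulrBr -sumrB trmx_mul trmxK -mulmxA mxE mulr_sumr -sumrB.
rewrite (le_trans (ler_norm_sum _ _ _))//.
apply: (@le_trans _ _ (\sum_(i < q1 + p2) K * e' * `|h|)).
  apply: ler_sum => i _; rewrite [_^T 0 i]mxE mulrBr; exact: term.
rewrite sumr_const card_ord -[X in X <= _]mulr_natl !mulrA ler_wpM2r//.
rewrite ler_pdivrMr; last by rewrite -mulrA; exact: D0.
by rewrite [X in _ <= X]mulrC ler_wpM2r ?(ltW e0)// lerDl.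
Qed.

End Merit.

(** * Global convergence *)

Section Method.
Context {R : realType} {p1 p2 q1 : nat}.
Variables (H : 'cV[R]_(p1 + p2) -> 'cV[R]_q1)
          (G : 'cV[R]_(p1 + p2) -> 'cV[R]_p2).
Hypotheses (HC1 : continuously_differentiable H)
           (GC1 : continuously_differentiable G).

Let differentiable_PsiFB_grad x : differentiable (PsiFB H G) x /\
  grad (PsiFB H G) x = (VFB H G x)^T *m FFB H G x.
Proof.
exact: strictly_differentiable_diff (strictly_differentiable_PsiFB HC1 GC1 x).
Qed.

Lemma grad_PsiFB x : grad (PsiFB H G) x = (VFB H G x)^T *m FFB H G x.
Proof. by have [] := differentiable_PsiFB_grad x. Qed.

Lemma continuous_PsiFB : continuous (PsiFB H G).
Proof.
move=> x; apply: differentiable_continuous.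
by have [] := differentiable_PsiFB_grad x.
Qed.

Lemma continuous_grad_PsiFB : continuous (grad (PsiFB H G)).
Proof.
have -> : grad (PsiFB H G) = fun x => (VFB H G x)^T *m FFB H G x.
  by apply/funext => x; exact: grad_PsiFB.
move=> x; apply: strictly_differentiable_continuous_grad.
exact: strictly_differentiable_PsiFB.
Qed.

Lemma PsiFB_ge0 x : 0 <= PsiFB H G x.
Proof. by rewrite mulr_ge0// sqr_ge0. Qed.

Lemma PsiFB_eq0 x : PsiFB H G x = 0 -> FFB H G x = 0.
Proof.
move=> /eqP; rewrite PsiFBE mulf_eq0 invr_eq0 pnatr_eq0/=.
rewrite psumr_eq0 => [/allP F0|i _]; last exact: sqr_ge0.
apply/colP => i; rewrite [RHS]mxE; have := F0 i (mem_index_enum _).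
by rewrite sqrf_eq0 => /eqP.
Qed.

(** [phiFB] and the maximum have the same zeros, and max(G_i, -xi_i) = 0 is exactly
    complementarity. *)
Lemma FFB_eq0_MNLCS x : FFB H G x = 0 -> MNLCS H G x.
Proof.
move=> F0.
have max0 i : Num.max (G x i 0) (- xi x i 0) = 0.
  by apply/eqP; rewrite -phiFB_eq0 -(FFB_r H) F0 mxE.
split.
- by apply/colP => i; rewrite -(FFB_l H G) F0 !mxE.
- by move=> i; rewrite -(max0 i) le_max lexx.
- by move=> i; rewrite -oppr_le0 -(max0 i) le_max lexx orbT.
apply/matrixP => i j; rewrite (ord1 i) (ord1 j) mxE big1 ?mxE// => k _.
rewrite mxE; have := max0 k; case: leP => _ /eqP.
  by rewrite oppr_eq0 => /eqP->; rewrite mulr0.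
by move=> /eqP->; rewrite mul0r.
Qed.

Variables kappa tau_abs sigma beta rho1 rho2 gamma1 gamma2 : R.
Hypotheses (kappa01 : 0 < kappa < 1) (sigma01 : 0 < sigma < 1)
  (beta01 : 0 < beta < 1) (rho1_gt0 : 0 < rho1) (rho2_gt0 : 0 < rho2).

(** The angle condition and the length bound that the global analysis uses. A retained direction
    satisfies them with [rho1] and [rho2]; the negative gradient with constant 1 and its own
    length. *)
Lemma safeguarded_dirP x d (D := safeguarded_dir H G rho1 rho2 x d) :
  'd (PsiFB H G) x D <=
    - (Num.min 1 rho1 * enorm (grad (PsiFB H G) x) * enorm D) /\
  Num.min rho2 (enorm (grad (PsiFB H G) x)) <= enorm D.
Proof.
rewrite {}/D /safeguarded_dir; case: ifPn => [_|].
  rewrite diff_grad enormN; split; last by rewrite ge_min lexx orbT.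
  rewrite mulmxN mxE lerN2 (_ : (_ *m _) 0 0 = enorm (grad (PsiFB H G) x) ^+ 2).
    rewrite -mulrA -expr2 ler_piMl ?sqr_ge0// ge_min lexx//.
  by rewrite enorm_sqr mxE; apply: eq_bigr => i _; rewrite mxE.
rewrite negb_or -!leNgt => /andP[dx dn]; split; last by rewrite ge_min dn.
rewrite (le_trans dx)// !mulNr lerN2 ler_wpM2r ?enorm_ge0//.
by rewrite ler_wpM2r ?enorm_ge0// ge_min lexx orbT.
Qed.

Variables z d : nat -> 'cV[R]_(p1 + p2).
Hypothesis gen :
  GLM_generated H G kappa tau_abs sigma beta rho1 rho2 gamma1 gamma2 z d.
Local Notation test k := (decrease_test H G kappa (z k) (d k)).
Local Notation Psi := (PsiFB H G).
Local Notation dir k := (safeguarded_dir H G rho1 rho2 (z k) (d k)).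

Lemma test_step k : test k -> z k.+1 = z k + d k.
Proof. by move=> t; have [_ [_]] := gen k; rewrite t. Qed.

Lemma armijo_step k : ~~ test k ->
  exists2 i, armijo_exponent H G sigma beta (z k) (dir k) i
           & z k.+1 = z k + beta ^+ i *: dir k.
Proof. by move=> /negPf t; have [_ [_]] := gen k; rewrite t. Qed.

Lemma PsiFB_nonincreasing : {homo (fun k => Psi (z k)) : n m / (n <= m)%N >-> m <= n}.
Proof.
apply/nonincreasing_seqP => k.
have [t|/armijo_step[i [_ ar _] ->]] := boolP (test k).
  rewrite (test_step t) (le_trans t)// ler_piMl ?PsiFB_ge0//.
  by case/andP: kappa01 => _ /ltW.
rewrite (le_trans ar)// gerDl.
have b0 : 0 <= beta ^+ i by rewrite exprn_ge0//; case/andP: beta01 => /ltW.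
have s0 : 0 <= sigma by case/andP: sigma01 => /ltW.
rewrite mulr_ge0_le0 ?mulr_ge0//.
have [/le_trans-> //] := safeguarded_dirP (z k) (d k).
rewrite oppr_le0 !mulr_ge0 ?enorm_ge0// le_min ler01 ltW//.
Qed.

Lemma PsiFB_cvg : exists l : R, [/\ 0 <= l, forall k, l <= Psi (z k)
  & forall e : R, 0 < e -> exists N, forall k, (N <= k)%N -> Psi (z k) < l + e].
Proof.
have lb : has_lbound (range (fun k => Psi (z k))).
  by exists 0 => _ [k _ <-]; exact: PsiFB_ge0.
have cv := nonincreasing_is_cvgn PsiFB_nonincreasing lb.
exists (limn (fun k => Psi (z k))); split.
- by apply: limr_ge => //; near=> k; exact: PsiFB_ge0.
- exact: nonincreasing_cvgn_ge PsiFB_nonincreasing cv.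
move=> e e0; have /cvgrPdist_lt/(_ e e0)[N _ hN] := cv.
exists N => k Nk; have := hN k Nk; rewrite /= distrC => /(le_lt_trans (ler_norm _)).
by rewrite ltrBlDl.
Unshelve. all: by end_near. Qed.

Lemma PsiFB_null : infinite_set [set k | test k] ->
  forall e : R, 0 < e -> exists N, forall k, (N <= k)%N -> Psi (z k) < e.
Proof.
move=> inft; have [l [l0 lk cv]] := PsiFB_cvg.
suff z0 : l = 0 by move=> e /cv[N hN]; exists N => k /hN; rewrite z0 add0r.
apply/eqP; rewrite eq_le l0 andbT leNgt; apply/negP => {}l0.
have /andP[k0 k1] := kappa01.
(* With this tolerance an accepted step would fall below l: kappa (1 + (1 - kappa)/2) < 1 amounts to
   (1 - kappa)(2 - kappa) > 0. *)
have [N hN] := cv (l * ((1 - kappa) / 2)) ltac:(rewrite mulr_gt0// divr_gt0// subr_gt0//).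
have [k Nk /= t] := infinite_set_frequently N inft.
have := lk k.+1; rewrite (test_step t) => /le_trans/(_ t).
have := hN k Nk; rewrite -(ltr_pM2l k0) => h /le_lt_trans/(_ h).
rewrite ltNge => /negP; apply.
have -> : kappa * (l + l * ((1 - kappa) / 2)) = l * (kappa * (1 + (1 - kappa) / 2)) by field.
rewrite ler_piMr ?ltW//.
have : 0 < (1 - kappa) * (2 - kappa) by rewrite mulr_gt0//; lra.
by lra.
Qed.

Lemma PsiFB_cluster0 x : infinite_set [set k | test k] ->
  cluster (z @ \oo) x -> FFB H G x = 0.
Proof.
move=> inft cx; apply: PsiFB_eq0; apply/eqP; rewrite eq_le PsiFB_ge0 andbT.
rewrite leNgt; apply/negP => Px.
have P2 : 0 < Psi x / 2 by rewrite divr_gt0.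
have [N hN] := PsiFB_null inft P2.
have /cvgr_dist_lt/(_ _ P2) := @continuous_PsiFB x.
move=> /(cluster_frequently N cx)[k Nk].
have := hN k Nk; move: (Psi x) (Psi (z k)) => a b hb.
by move=> /(le_lt_trans (ler_norm _)) hab; lra.
Qed.

(* If the gradient does not vanish at the accumulation point, a late iterate
   near it has a rejected Armijo trial step so short that strict
   differentiability shows it should have been accepted. *)
Lemma armijo_cluster_stationary x N0 :
  (forall k, (N0 <= k)%N -> ~~ test k) ->
  cluster (z @ \oo) x -> grad Psi x = 0.
Proof.
move=> ntest cx; apply: contrapT => /eqP; rewrite -normr_gt0.
set g := `|_| => g0.
have /andP[s0 s1] := sigma01; have /andP[b0 b1] := beta01.
pose c := Num.min 1 rho1; have c0 : 0 < c by rewrite lt_min ltr01.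
have g2 : 0 < g / 2 by rewrite divr_gt0.
have ng : \forall y \near x, g / 2 <= enorm (grad Psi y).
  apply: filterS (near_norm_half (@continuous_grad_PsiFB x) g0) => y.
  by move/le_trans; apply; exact: norm_le_enorm.
pose m := Num.min rho2 (g / 2); have m0 : 0 < m by rewrite lt_min rho2_gt0.
(* The slack in the Armijo test per unit of step length, as the descent rate near x is at least c
   g/2. *)
pose e := (1 - sigma) * (c * (g / 2)).
have cg0 : 0 < c * (g / 2) by rewrite mulr_gt0.
have e0 : 0 < e by rewrite mulr_gt0// subr_gt0.
have /near_pairP[r r0 hr] := strictly_differentiable_PsiFB HC1 GC1 x e0.
have r2 : 0 < r / 2 by rewrite divr_gt0.
(* A step shorter than eta has exponent above 1, because its direction has length at least m, and
   the trial step before it is shorter than r/2. *)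
pose eta := beta * Num.min m (r / 2).
have eta0 : 0 < eta by rewrite mulr_gt0// lt_min m0.
have [l [_ lk cv]] := PsiFB_cvg.
(* A step of length at least eta would lower [Psi] by at least this tolerance, hence below its
   limit. *)
have [N1 hN1] := cv (sigma * (c * (g / 2)) * eta) (mulr_gt0 (mulr_gt0 s0 cg0) eta0).
have nx : \forall y \near x, `|y - x| < r / 2.
  by apply/nbhs_ballP; exists (r / 2) => // y; rewrite -ball_normE/= distrC.
have [k] := cluster_frequently (maxn N0 N1) cx (filterI ng nx).
rewrite geq_max => /andP[Nk0 Nk1] [gk xk].
have [i [i0 ar imin] zk] := armijo_step (ntest k Nk0).
have [dD nD] := safeguarded_dirP (z k) (d k).
move: ar imin zk dD nD; set D := dir k => ar imin zk dD nD.
have Dm : m <= enorm D by rewrite (le_trans _ nD)// le_min !ge_min lexx gk orbT.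
have D0 : 0 < enorm D := lt_le_trans m0 Dm.
have dD' : 'd Psi (z k) D <= - (c * (g / 2) * enorm D).
  by rewrite (le_trans dD)// lerN2 ler_wpM2r ?(ltW D0)// ler_wpM2l// ltW.
have step : beta ^+ i * enorm D < eta.
  rewrite -(ltr_pM2l (mulr_gt0 s0 cg0)).
  have := hN1 k Nk1; have := lk k.+1; have := ar; rewrite /armijo -zk.
  have bi : 0 < beta ^+ i by rewrite exprn_gt0.
  have : beta ^+ i * sigma * 'd Psi (z k) D <=
         beta ^+ i * sigma * - (c * (g / 2) * enorm D).
    by rewrite ler_wpM2l// mulr_ge0// ltW.
  move: ('d Psi (z k) D : R) (Psi (z k) : R) (Psi (z k.+1) : R) => a P P' ha h1 h2 h3.
  have -> : sigma * (c * (g / 2)) * (beta ^+ i * enorm D) =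
     - (beta ^+ i * sigma * - (c * (g / 2) * enorm D)) by ring.
  move: (_ * eta) h3 (_ * - _) ha => A h3 B; move: (_ * a) h1 => C h1 ha; lra.
have bi : beta ^+ i < beta.
  rewrite -(ltr_pM2r D0) (lt_le_trans step)// ler_wpM2l ?(ltW b0)//.
  by rewrite ge_min Dm.
(* The exponent is at least 2, so its predecessor is still positive and was rejected by the line
   search. *)
case: i i0 ar imin zk step bi => // -[|j] _ ar imin zk step bi.
  by rewrite expr1 ltxx in bi.
set b := beta ^+ j.+1 in step bi *.
have bj0 : 0 < beta ^+ j.+1 by rewrite exprn_gt0.
have stepj : beta ^+ j.+1 * enorm D < r / 2.
  rewrite -(ltr_pM2l b0) mulrA -exprS (lt_le_trans step)//.
  by rewrite ler_wpM2l ?(ltW b0)// ge_min lexx orbT.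
have : ~~ armijo H G sigma beta (z k) D j.+1.
  by apply/negP => /(imin j.+1 isT); rewrite ltnn.
rewrite /armijo -ltNge; apply/negP; rewrite -leNgt.
have yk : `|z k + beta ^+ j.+1 *: D - x| < r.
  rewrite addrAC (le_lt_trans (ler_normD _ _))// normrZ (gtr0_norm bj0).
  have : beta ^+ j.+1 * `|D| <= beta ^+ j.+1 * enorm D.
    by rewrite ler_wpM2l ?(ltW bj0)// norm_le_enorm.
  by lra.
have xk' : `|z k - x| < r by lra.
have := hr _ _ xk' yk => /=.
have -> : z k + beta ^+ j.+1 *: D - z k = beta ^+ j.+1 *: D.
  by rewrite addrAC subrr add0r.
rewrite -grad_PsiFB -diff_grad normrZ (gtr0_norm bj0).
have -> : 'd Psi (z k) (beta ^+ j.+1 *: D) = beta ^+ j.+1 * 'd Psi (z k) D.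
  by rewrite linearZ.
move=> /(le_trans (ler_norm _)).
have : beta ^+ j.+1 * ((1 - sigma) * 'd Psi (z k) D) <=
       beta ^+ j.+1 * ((1 - sigma) * - (c * (g / 2) * enorm D)).
  by rewrite ler_wpM2l ?(ltW bj0)// ler_wpM2l// subr_ge0 ltW.
have : e * (beta ^+ j.+1 * `|D|) <= e * (beta ^+ j.+1 * enorm D).
  by rewrite ler_wpM2l ?(ltW e0)// ler_wpM2l ?(ltW bj0)// norm_le_enorm.
rewrite /e.
move: ('d Psi (z k) D : R) (Psi (_ + _) : R) (Psi (z k) : R) => a P P'.
move: (c * (g / 2)) (beta ^+ j.+1) (enorm D) (`|D|) => A B E F.
by lra.
Qed.

(** If the test succeeds infinitely often, [FFB] vanishes at x and the gradient, a matrix times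
    [FFB], with it; otherwise all late steps are Armijo steps. *)
Lemma cluster_stationary x : cluster (z @ \oo) x -> grad Psi x = 0.
Proof.
move=> cx; have [inft|] := pselect (infinite_set [set k | test k]).
  by rewrite grad_PsiFB (PsiFB_cluster0 inft cx) mulmx0.
move=> /contrapT/finite_seqP[s hs].
apply: (armijo_cluster_stationary (N0 := (\max_(k <- s) k).+1)) => // k Nk.
apply/negP => t; have : k \in s by have : [set k | test k] k by []; rewrite hs.
by move=> ks; move: Nk; rewrite ltnNge => /negP; apply; exact: leq_bigmax_seq.
Qed.

End Method.

(** * Local analysis of the residuals *)

Section LocalAnalysis.
Context {R : realType} {p1 p2 q1 : nat}.
Variables (H : 'cV[R]_(p1 + p2) -> 'cV[R]_q1)
          (G : 'cV[R]_(p1 + p2) -> 'cV[R]_p2).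
Hypotheses (HC1 : continuously_differentiable H)
           (GC1 : continuously_differentiable G).
Implicit Types z v : 'cV[R]_(p1 + p2).

Lemma Ilt_Ige z i : (i \in Ilt G z) = (i \notin Ige G z).
Proof. by rewrite !inE ltNge. Qed.

Lemma DNFmaxE z : DNFmax H G z =
  col_mx (jac H z) (DI (Ige G z) *m jac G z - row_mx 0 (DI (Ilt G z))).
Proof.
rewrite /DNFmax block_mxEh /Hw /Hxi /Gw /Gxi.
rewrite -[in RHS](hsubmxK (jac H z)) -[in RHS](hsubmxK (jac G z)).
by rewrite mul_mx_row opp_row_mx add_row_mx oppr0 addr0 -block_mxEh -block_mxEv.
Qed.

Lemma DNFmax_mul_l z v i :
  (DNFmax H G z *m v) (lshift p2 i) 0 = (jac H z *m v) i 0.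
Proof. by rewrite DNFmaxE mul_col_mx col_mxEu. Qed.

Lemma DNFmax_mul_r z v i : (DNFmax H G z *m v) (rshift q1 i) 0 =
  if i \in Ige G z then (jac G z *m v) i 0 else - xi v i 0.
Proof.
rewrite DNFmaxE mul_col_mx col_mxEd mulmxBl mxBE -mulmxA.
rewrite -[in X in _ - X](vsubmxK v) mul_row_col mul0mx add0r !diag_row_mulE Ilt_Ige.
by case: (i \in Ige G z) => /=; rewrite !(mul1r, mul0r, subr0, sub0r).
Qed.

Lemma Fmax_l z i : Fmax H G z (lshift p2 i) 0 = H z i 0.
Proof. by rewrite col_mxEu. Qed.

Lemma Fmax_r z i :
  Fmax H G z (rshift q1 i) 0 = if i \in Ige G z then G z i 0 else - xi z i 0.
Proof. by rewrite col_mxEd mxE inE; case: leP. Qed.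

Lemma FFB_Fmax z : `|FFB H G z| <= 4 * `|Fmax H G z| /\
  `|Fmax H G z| <= 2 * `|FFB H G z|.
Proof.
have max_r i : Num.max (G z i 0) (- xi z i 0) = Fmax H G z (rshift q1 i) 0.
  by rewrite col_mxEd [RHS]mxE.
split; apply: mx_norm_le => [|k j]; rewrite ?mulr_ge0// (ord1 j);
  case: (split_ordP k) => i ->.
- rewrite FFB_l -Fmax_l (le_trans (le_mx_entry _ _ _))//.
  by rewrite ler_peMl// (ler_nat _ 1 4).
- rewrite FFB_r; have /andP[_ /le_trans->//] := phiFB_max (G z i 0) (- xi z i 0).
  by rewrite ler_wpM2l// max_r le_mx_entry.
- rewrite Fmax_l -(FFB_l H G) (le_trans (le_mx_entry _ _ _))//.
  by rewrite ler_peMl// (ler_nat _ 1 2).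
- rewrite -max_r; have /andP[+ _] := phiFB_max (G z i 0) (- xi z i 0).
  rewrite -(FFB_r H) => h.
  have := le_mx_entry (FFB H G z) (rshift q1 i) 0.
  move: h; move: (`|Num.max _ _|) (`|FFB H G z _ _|) (`|FFB H G z|) => a b c.
  by lra.
Qed.

(** In the maximum norm it suffices to match each row of [CQ_mx] with one row of [DNFmax]. The two
    inclusions provide the match: rows of G for indices in [Ige], negative unit rows for indices in
    [Ilt]. Only rows of Jacobians are perturbed. *)
Lemma CQ_mx_mul_le z0 z v (I : {set 'I_p2}) e : 0 <= e ->
  (Ipos G z0 :|: I \subset Ige G z) ->
  (Ineg G z0 :|: (I00 G z0 :\: I) \subset Ilt G z) ->
  `|jac H z0 - jac H z| <= e -> `|jac G z0 - jac G z| <= e ->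
  `|CQ_mx H G z0 I *m v| <= `|DNFmax H G z *m v| + (p1 + p2)%:R * e * `|v|.
Proof.
move=> e0 sge slt He Ge.
have pert m (A B : 'M[R]_(m, p1 + p2)) i : `|A - B| <= e ->
    `|(A *m v) i 0| <= `|(B *m v) i 0| + (p1 + p2)%:R * e * `|v|.
  move=> AB; rewrite -lerBlDl (le_trans (lerB_dist _ _))// -mxBE -mulmxBl.
  rewrite (le_trans (le_mx_entry _ _ _))// (le_trans (mx_norm_mul _ _))//.
  by rewrite ler_wpM2r// ler_wpM2l.
have pe : 0 <= (p1 + p2)%:R * e * `|v| by rewrite !mulr_ge0.
apply: mx_norm_le => [|k j]; first by rewrite addr_ge0.
rewrite (ord1 j).
case: (split_ordP k) => {}k ->.
  rewrite /CQ_mx mul_col_mx col_mxEu /Hw /Hxi hsubmxK.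
  rewrite (le_trans (pert _ _ _ k He))//.
  by rewrite lerD2r -(DNFmax_mul_l z v k) le_mx_entry.
rewrite /CQ_mx mul_col_mx col_mxEd mul_col_mx; case: (split_ordP k) => {}k ->.
  rewrite col_mxEu row_mx_rows_in /Gw /Gxi hsubmxK mul_rows_in.
  set i := enum_val k; rewrite (le_trans (pert _ _ _ i Ge))//.
  have iI : i \in Ige G z by exact: (fintype.subsetP sge _ (enum_valP k)).
  have := DNFmax_mul_r z v i; rewrite iI => <-.
  by rewrite lerD2r le_mx_entry.
rewrite col_mxEd -[in X in X <= _](vsubmxK v) mul_row_col mul0mx add0r mulNmx.
rewrite mxNE normrN mul_rows_in mul1mx.
set i := enum_val k; have iI : i \in Ilt G z.
  by exact: (fintype.subsetP slt _ (enum_valP k)).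
have := DNFmax_mul_r z v i; rewrite -[_ \in _]negbK -Ilt_Ige iI/= => h.
by rewrite -normrN -[X in `|X|]h (le_trans (le_mx_entry _ _ _))// lerDl.
Qed.

Variable z0 : 'cV[R]_(p1 + p2).
Hypothesis z0_sol : MNLCS H G z0.

(** The summands of the scalar product share one sign, so each of them vanishes. *)
Lemma MNLCS_sign i : (G z0 i 0 = 0 \/ G z0 i 0 < 0 /\ xi z0 i 0 = 0) /\ 0 <= xi z0 i 0.
Proof.
have [_ G0 x0 Gx] := z0_sol; split => //.
have : (- ((G z0)^T *m xi z0)) 0 0 = 0 by rewrite Gx oppr0 mxE.
rewrite mxE [X in - X]mxE -sumrN => /eqP.
rewrite psumr_eq0 => [/allP/(_ i (mem_index_enum _))|k _].
  rewrite mxE oppr_eq0 mulf_eq0 => /orP[/eqP->|/eqP x0']; first by left.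
  by have := G0 i; rewrite le_eqVlt => /orP[/eqP->|]; [left|right].
by rewrite mxE oppr_ge0 mulr_le0_ge0.
Qed.

(* Whether i lies in Ige z is the sign of G_i + xi_i, which is stable near z0
   unless i lies in I00 z0. *)
Lemma near_Ige : \forall z \near z0, forall i,
  (i \in Ige G z -> G z0 i 0 = 0) /\ (i \notin Ige G z -> xi z0 i 0 = 0).
Proof.
have [dG _] := GC1.
have cs i : {for z0, continuous (fun z : 'cV[R]_(p1 + p2) => G z i 0 + z (rshift p1 i) 0 : R)}.
  apply: (@cvgD _ _ _ (nbhs z0)); last exact: coord_continuous.
  have : {for z0, continuous ((fun A : 'cV[R]_p2 => A i 0 : R) \o G)}.
    apply: continuous_comp; first exact: differentiable_continuous.
    exact: coord_continuous.
  exact.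
apply: (@filter_forall _ _ (fun i z => (i \in Ige G z -> G z0 i 0 = 0) /\
  (i \notin Ige G z -> xi z0 i 0 = 0)) (nbhs z0)) => i.
have [sG x0] := MNLCS_sign i.
have IgeE z : (i \in Ige G z) = (0 <= G z i 0 + z (rshift p1 i) 0).
  by rewrite inE xiE -subr_ge0 opprK.
rewrite xiE in sG x0 *.
have [s0|s0|s0] := ltgtP (G z0 i 0 + z0 (rshift p1 i) 0) 0.
- apply: filterS (cvgr_lt _ (cs i) _ s0) => z sz; rewrite IgeE leNgt sz; split=> // _.
  by case: sG => [G0|[]//]; move: s0; rewrite G0 add0r ltNge x0.
- apply: filterS (cvgr_gt _ (cs i) _ s0) => z sz; rewrite IgeE ltW//; split=> // _.
  by case: sG => // -[G0 xz]; move: s0; rewrite xz addr0 => /(lt_trans G0); rewrite ltxx.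
(* With sum zero, complementarity makes both G_i and xi_i vanish at [z0], so either branch is
   allowed at z. *)
- apply: filterE => z; split=> _; case: sG => [G0|[G0 xz]] //.
    by move: s0; rewrite xz addr0.
  by move: s0; rewrite G0 add0r.
Qed.

End LocalAnalysis.

(** * Error bound for one regularized normal equation *)

Section LevenbergMarquardtStep.
Context {R : realType}.

(** Here e is the current error and w = e + d the next one. The system becomes (D^T D + nu) w = -D^T
    (F - D e) + nu e. Pairing with w, dropping nu |w|^2 on the left and bounding |w|^2 by c^2 |D
    w|^2, one divides by |w|. *)
Lemma LM_error m n (D : 'M[R]_(m, n)) (F : 'cV[R]_m) (e d : 'cV[R]_n) (nu c L E : R) :
  (D^T *m D + nu%:M) *m d = - (D^T *m F) -> 0 <= nu -> 0 <= c -> 0 <= L -> 0 <= E ->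
  (forall v : 'cV[R]_n, `|v| <= c * `|D *m v|) ->
  (forall v : 'cV[R]_n, `|D *m v| <= L * `|v|) ->
  `|F - D *m e| <= E ->
  `|e + d| <= c ^+ 2 * (m%:R * L * E + n%:R * nu * `|e|).
Proof.
move=> LM nu0 c0 L0 E0 lo up rem; set w := e + d.
have lin : (D^T *m D + nu%:M) *m w = - (D^T *m (F - D *m e)) + nu *: e.
  rewrite /w mulmxDr LM mulmxDl mul_scalar_mx mulmxBr opprB.
  by rewrite mulmxA addrAC.
clearbody w.
have normal : ((D *m w)^T *m (D *m w)) 0 0 + nu * (w^T *m w) 0 0 =
    - ((D *m w)^T *m (F - D *m e)) 0 0 + nu * (w^T *m e) 0 0.
  have := congr1 (mulmx w^T) lin.
  have dot a (b : 'M[R]_(m, a)) : w^T *m (D^T *m b) = (D *m w)^T *m b.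
    by rewrite trmx_mul mulmxA.
  rewrite mulmxDl mul_scalar_mx -mulmxA mulmxDr dot -scalemxAr.
  rewrite mulmxDr mulmxN dot -scalemxAr => /matrixP/(_ 0 0).
  by rewrite !mxDE !mxZE mxNE.
have wD : `|w| ^+ 2 <= c ^+ 2 * ((D *m w)^T *m (D *m w)) 0 0.
  rewrite (@le_trans _ _ ((c * `|D *m w|) ^+ 2))//.
    by rewrite ler_sqr ?nnegrE ?mulr_ge0.
  by rewrite exprMn ler_wpM2l ?sqr_ge0// dotmx_ge_sqr.
have ww : 0 <= nu * (w^T *m w) 0 0.
  by rewrite mulr_ge0// (le_trans _ (dotmx_ge_sqr _)) ?sqr_ge0.
have t1 : - ((D *m w)^T *m (F - D *m e)) 0 0 <= m%:R * L * `|w| * E.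
  rewrite (le_trans (ler_norm _))// normrN (le_trans (norm_dotmx _ _))//.
  by rewrite ler_pM// ?mulr_ge0// -mulrA ler_wpM2l// up.
have t2 : nu * (w^T *m e) 0 0 <= nu * (n%:R * `|w| * `|e|).
  by rewrite ler_wpM2l// (le_trans (ler_norm _))// norm_dotmx.
have main : `|w| * `|w| <= `|w| * (c ^+ 2 * (m%:R * L * E + n%:R * nu * `|e|)).
  rewrite -expr2 (le_trans wD)// mulrCA ler_wpM2l ?sqr_ge0//.
  have -> : `|w| * (m%:R * L * E + n%:R * nu * `|e|) =
    m%:R * L * `|w| * E + nu * (n%:R * `|w| * `|e|) by ring.
  by rewrite (le_trans _ (lerD t1 t2))// -normal lerDl.
have [w0|w0] := eqVneq `|w| 0.
  by rewrite w0 mulr_ge0 ?sqr_ge0// addr_ge0 ?mulr_ge0.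
have wp : 0 < `|w| by rewrite lt0r w0 normr_ge0.
by rewrite -(ler_pM2l wp).
Qed.

End LevenbergMarquardtStep.

(** * Uniform bounds for [DNFmax] near a solution *)

Section LocalConvergence.
Context {R : realType} {p1 p2 q1 : nat}.
Variables (H : 'cV[R]_(p1 + p2) -> 'cV[R]_q1)
          (G : 'cV[R]_(p1 + p2) -> 'cV[R]_p2).
Hypotheses (HC1 : continuously_differentiable H)
           (GC1 : continuously_differentiable G).
Implicit Types z v : 'cV[R]_(p1 + p2).
Variable z0 : 'cV[R]_(p1 + p2).
Hypothesis z0_sol : MNLCS H G z0.

(** The branch of the maximum active at z vanishes at [z0]. Hence each row is a Taylor remainder of
    H or G, or exactly zero when the branch is -xi_i. *)
Lemma Fmax_remainder z E : 0 <= E ->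
  (forall i, (i \in Ige G z -> G z0 i 0 = 0) /\ (i \notin Ige G z -> xi z0 i 0 = 0)) ->
  `|H z0 - H z - jac H z *m (z0 - z)| <= E ->
  `|G z0 - G z - jac G z *m (z0 - z)| <= E ->
  `|Fmax H G z - DNFmax H G z *m (z - z0)| <= E.
Proof.
move=> E0 ind rH rG.
have [H0 _ _ _] := z0_sol.
have neg m (A : 'M[R]_(m, p1 + p2)) : A *m (z - z0) = - (A *m (z0 - z)).
  by rewrite -mulmxN opprB.
apply: mx_norm_le => // k j; rewrite (ord1 j) mxBE.
case: (split_ordP k) => i ->.
  rewrite Fmax_l DNFmax_mul_l neg mxNE opprK.
  have := le_trans (le_mx_entry _ i 0) rH; rewrite H0 sub0r mxBE mxNE.
  by rewrite -normrN opprD !opprK.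
rewrite Fmax_r DNFmax_mul_r; have [iI iI'] := ind i; case: ifPn => [/iI G0|/iI' x0].
  have := le_trans (le_mx_entry _ i 0) rG; rewrite !mxBE G0 sub0r.
  by rewrite neg mxNE opprK -normrN opprD !opprK.
by rewrite opprK !xiE mxBE -[z0 _ _]xiE x0 subr0 addNr normr0.
Qed.

Lemma near_DNFmax_upper : exists2 L : R, 0 < L &
  \forall z \near z0, forall v, `|DNFmax H G z *m v| <= L * `|v|.
Proof.
pose B := (`|jac H z0| + 1) + (`|jac G z0| + 1).
have B0 : 0 < B by rewrite addr_gt0 ?ltr_wpDl.
(* The summand 1 accounts for the rows -xi_i. *)
exists ((p1 + p2)%:R * B + 1); first by rewrite ltr_wpDl// mulr_ge0// ltW.
have jH := near_norm_le (HC1.2 z0); have jG := near_norm_le (GC1.2 z0).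
apply: filterS2 jH jG => z jH jG v.
have ent m (A : 'M[R]_(m, p1 + p2)) i : `|A| <= B ->
    `|(A *m v) i 0| <= ((p1 + p2)%:R * B + 1) * `|v|.
  move=> AB; rewrite (le_trans (le_mx_entry _ _ _))// (le_trans (mx_norm_mul _ _))//.
  by rewrite ler_wpM2r// ler_wpDr// ler_wpM2l.
have jHB : `|jac H z| <= B by rewrite (le_trans jH)// lerDl addr_ge0.
have jGB : `|jac G z| <= B by rewrite (le_trans jG)// lerDr addr_ge0.
apply: mx_norm_le => [|k j]; first by rewrite mulr_ge0// addr_ge0// mulr_ge0// ltW.
rewrite (ord1 j); case: (split_ordP k) => i ->.
  by rewrite DNFmax_mul_l ent.
rewrite DNFmax_mul_r; case: ifP => _; first by rewrite ent.
rewrite normrN xiE (le_trans (le_mx_entry _ _ _))// ler_peMl// lerDr mulr_ge0// ltW//.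
Qed.

Hypothesis CQ : forall I : {set 'I_p2}, I \subset I00 G z0 ->
  row_free (CQ_mx H G z0 I)^T.

(** There are finitely many [I], and the sum of their constants dominates each of them. *)
Lemma CQ_lower_bound : exists2 C : R, 0 < C &
  forall (I : {set 'I_p2}) v, I \subset I00 G z0 -> `|v| <= C * `|CQ_mx H G z0 I *m v|.
Proof.
have /choice[f hf] : forall I : {set 'I_p2}, exists c : R, 0 < c /\
    (I \subset I00 G z0 -> forall v, `|v| <= c * `|CQ_mx H G z0 I *m v|).
  move=> I; have [sI|nI] := boolP (I \subset I00 G z0); last by exists 1.
  by have [c c0 hc] := row_free_trmx_lower_bound (CQ sI); exists c.
have f0 I : 0 <= f I by have [/ltW] := hf I.
exists (1 + \sum_I f I); first by rewrite ltr_pwDl// sumr_ge0.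
move=> I v sI; have [_ /(_ sI v)/le_trans-> //] := hf I.
rewrite ler_wpM2r// (bigD1 I)//= addrCA lerDl addr_ge0// sumr_ge0//.
Qed.

Lemma near_DNFmax_lower : exists2 C : R, 0 < C &
  \forall z \near z0, forall v, `|v| <= C * `|DNFmax H G z *m v|.
Proof.
have [C C0 hC] := CQ_lower_bound; exists (2 * C); first by rewrite mulr_gt0.
(* Makes the perturbation at most |v|/2, to be absorbed on the left; the successor allows dimension
   0. *)
pose e := (2 * C * (p1 + p2).+1%:R)^-1.
have e0 : 0 < e by rewrite invr_gt0 !mulr_gt0.
have /cvgr_dist_le/(_ _ e0) jH := HC1.2 z0.
have /cvgr_dist_le/(_ _ e0) jG := GC1.2 z0.
apply: filterS3 (near_Ige GC1 z0_sol) jH jG => z ind jH jG v.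
(* The undecided indices are split as z splits them; by [near_Ige] all other indices are on the side
   prescribed by [z0]. *)
pose I := Ige G z :&: I00 G z0.
have sI : I \subset I00 G z0 by rewrite subsetIr.
have s1 : Ipos G z0 :|: I \subset Ige G z.
  apply/fintype.subsetP => i; rewrite finset.in_setU finset.in_setI => /orP[|/andP[]//].
  rewrite inE => /andP[_ x0]; apply: contraTT x0 => ni.
  by have [_ /(_ ni) ->] := ind i; rewrite ltxx.
have s2 : Ineg G z0 :|: (I00 G z0 :\: I) \subset Ilt G z.
  apply/fintype.subsetP => i; rewrite Ilt_Ige finset.in_setU finset.in_setD finset.in_setI.
  move=> /orP[|].
    rewrite inE; apply: contraTN => ni.
    by have [/(_ ni) -> _] := ind i; rewrite ltxx.
  by case/andP => + i0; rewrite i0 andbT.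
have := hC I v sI.
have := CQ_mx_mul_le v (ltW e0) s1 s2 jH jG.
rewrite -(ler_pM2l C0) => h /le_trans/(_ h); rewrite mulrDr.
have : C * ((p1 + p2)%:R * e * `|v|) <= 2^-1 * `|v|.
  rewrite mulrA ler_wpM2r//.
  have N0 : 0 < (p1 + p2).+1%:R :> R by [].
  have : (p1 + p2)%:R <= (p1 + p2).+1%:R :> R by rewrite ler_nat.
  rewrite /e; move: N0; move: ((p1 + p2).+1%:R : R) ((p1 + p2)%:R : R) => N n N0 nN.
  have -> : C * (n * (2 * C * N)^-1) = n / N / 2.
    by field; rewrite !gt_eqF.
  by rewrite ler_piMl ?invr_ge0// ler_pdivrMr// mul1r.
move: (C * (_ * _ * _)) => a; rewrite -mulrA.
by move: (C * `|_|) (`|v|) => b w; lra.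
Qed.

End LocalConvergence.

(** * Fast local convergence *)

Section FastConvergence.
Context {R : realType} {p1 p2 q1 : nat}.
Variables (H : 'cV[R]_(p1 + p2) -> 'cV[R]_q1)
          (G : 'cV[R]_(p1 + p2) -> 'cV[R]_p2).
Hypotheses (HC1 : continuously_differentiable H)
           (GC1 : continuously_differentiable G).
Variable z0 : 'cV[R]_(p1 + p2).

(** The bound [E] is left open so that one step estimate serves both rates: e |z - z0| for C^1 data,
    c |z - z0|^2 for Lipschitz derivatives. *)
Definition jac_remainders_le z (E : R) :=
  `|H z0 - H z - jac H z *m (z0 - z)| <= E /\
  `|G z0 - G z - jac G z *m (z0 - z)| <= E.

Lemma near_remainders e : 0 < e ->
  \forall z \near z0, jac_remainders_le z (e * `|z - z0|).
Proof.
move=> e0.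
apply: filterS2 (near_pair_left (near_jac_remainder z0 HC1 e0))
  (near_pair_left (near_jac_remainder z0 GC1 e0)) => z.
by rewrite /jac_remainders_le /= (distrC z).
Qed.

Lemma near_remainders_lipschitz :
  locally_lipschitz_jac G -> locally_lipschitz_jac H ->
  exists2 c : R, 0 < c &
    \forall z \near z0, jac_remainders_le z (c * `|z - z0| ^+ 2).
Proof.
move=> lG lH.
have [c c0 hc] := near_jac_remainder_lipschitz z0 HC1.1 lH.
have [c' c'0 hc'] := near_jac_remainder_lipschitz z0 GC1.1 lG.
exists (c + c'); first exact: addr_gt0.
apply: filterS2 (near_pair_left hc) (near_pair_left hc') => z /=.
rewrite (distrC z) => hH hG; split.
  by rewrite (le_trans hH)// ler_wpM2r ?sqr_ge0// lerDl ltW.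
by rewrite (le_trans hG)// ler_wpM2r ?sqr_ge0// lerDr ltW.
Qed.

Hypothesis z0_sol : MNLCS H G z0.
Hypothesis CQ : forall I : {set 'I_p2}, I \subset I00 G z0 ->
  row_free (CQ_mx H G z0 I)^T.

(** [FFB] is comparable with [Fmax], which is [DNFmax] applied to z - z0 up to a small remainder,
    and [DNFmax] is bounded from both sides. *)
Lemma near_FFB_error_bound : exists2 M : R, 0 < M & \forall z \near z0,
  `|FFB H G z| <= M * `|z - z0| /\ `|z - z0| <= M * `|FFB H G z|.
Proof.
have [L L0 hL] := near_DNFmax_upper HC1 GC1 z0.
have [C C0 hC] := near_DNFmax_lower HC1 GC1 z0_sol CQ.
(* Multiplied by C, the remainder is at most |z - z0|/2 and is absorbed. *)
have e0 : 0 < (2 * C)^-1 by rewrite invr_gt0 mulr_gt0.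
exists (4 * (L + (2 * C)^-1) + 4 * C); first by rewrite !(addr_gt0, mulr_gt0).
apply: filterS2 (filterI hL hC)
  (filterI (near_Ige GC1 z0_sol) (near_remainders e0)) => z [{}hL {}hC] [ind [rH rG]].
have := Fmax_remainder z0_sol (mulr_ge0 (ltW e0) (normr_ge0 _)) ind rH rG.
have := hL (z - z0); have := hC (z - z0); have [] := FFB_Fmax H G z.
have := ler_normD (Fmax H G z - DNFmax H G z *m (z - z0)) (DNFmax H G z *m (z - z0)).
rewrite subrK.
have := ler_normB (Fmax H G z) (Fmax H G z - DNFmax H G z *m (z - z0)).
rewrite opprB addrC subrK.
move: (`|FFB H G z|) (`|Fmax H G z|) (`|DNFmax H G z *m _|) (`|_ - _ *m _|) (`|z - z0|)
  (normr_ge0 (FFB H G z)) (normr_ge0 (z - z0)).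
move=> fb fm dz r x fb0 x0 h1 h2 h3 h4 h5 h6 h7.
have Cr : C * r <= x / 2.
  have -> : x / 2 = C * ((2 * C)^-1 * x) by field; rewrite gt_eqF.
  by rewrite ler_pM2l.
have Cdz : C * dz <= C * (fm + r) by rewrite ler_pM2l.
have Cfm : C * fm <= C * (2 * fb) by rewrite ler_pM2l.
have Cx : 0 <= C * x by rewrite mulr_ge0// ltW.
have Lfb : 0 <= L * fb by rewrite mulr_ge0// ltW.
have efb : 0 <= (2 * C)^-1 * fb by rewrite mulr_ge0// ltW.
move: ((2 * C)^-1) e0 h7 efb => e e0 h7 efb.
by split; lra.
Qed.

Variables kappa gamma1 gamma2 : R.
Hypotheses (kappa01 : 0 < kappa < 1) (gamma1_gt0 : 0 < gamma1)
  (gamma2_gt0 : 0 < gamma2).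
Local Notation LM := (LM_system H G gamma1 gamma2).

(** Since nu is at most gamma2 times the norm of [FFB], it is O(|z - z0|), so regularization costs
    only a term of order |z - z0|^2. *)
Lemma near_LM_step : exists2 K : R, 0 < K & \forall z \near z0, forall E d,
  0 <= E -> jac_remainders_le z E -> LM z d ->
  `|z + d - z0| <= K * (E + `|z - z0| ^+ 2).
Proof.
have [L L0 hL] := near_DNFmax_upper HC1 GC1 z0.
have [C C0 hC] := near_DNFmax_lower HC1 GC1 z0_sol CQ.
have [M M0 hM] := near_FFB_error_bound.
pose m : R := (q1 + p2)%:R; pose n : R := (p1 + p2)%:R.
have m0 : 0 <= m by []. have n0 : 0 <= n by [].
pose A := C ^+ 2 * (m * L); pose B := C ^+ 2 * (n * (gamma2 * (m * M))).
have A0 : 0 <= A by rewrite mulr_ge0 ?sqr_ge0// mulr_ge0// ltW.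
have B0 : 0 <= B.
  by rewrite mulr_ge0 ?sqr_ge0// mulr_ge0// mulr_ge0 ?(ltW gamma2_gt0)// mulr_ge0// ltW.
exists (A + B + 1); first by rewrite ltr_wpDl// addr_ge0.
apply: filterS3 (filterI hL hC) hM (near_Ige GC1 z0_sol)
  => z [{}hL {}hC] [{}hM _] ind E d E0 [rH rG] lm.
have rem := Fmax_remainder z0_sol E0 ind rH rG.
have nu0 : 0 <= nu H G gamma1 gamma2 z.
  by rewrite le_min (ltW gamma1_gt0) mulr_ge0 ?enorm_ge0// ltW.
have nuM : nu H G gamma1 gamma2 z <= gamma2 * (m * (M * `|z - z0|)).
  rewrite ge_min; apply/orP; right; rewrite ler_pM2l//.
  by rewrite (le_trans (enorm_le_norm _))// ler_wpM2l.
rewrite addrAC (le_trans (LM_error lm nu0 (ltW C0) (ltW L0) E0 hC hL rem))//.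
rewrite -/m -/n; move: (`|z - z0|) (normr_ge0 (z - z0)) nuM => x x0 nuM.
rewrite [x ^+ 2]expr2.
have : C ^+ 2 * (n * nu H G gamma1 gamma2 z * x) <=
       C ^+ 2 * (n * (gamma2 * (m * (M * x))) * x).
  by rewrite ler_wpM2l ?sqr_ge0// ler_wpM2r// ler_wpM2l.
rewrite (_ : _ * (_ * (gamma2 * _) * x) = B * (x * x)); last by rewrite /B; ring.
have xx : 0 <= x * x by rewrite mulr_ge0.
rewrite mulrDr (_ : C ^+ 2 * (m * L * E) = A * E); last by rewrite /A; ring.
move=> hB; rewrite (le_trans (lerD (lexx _) hB))//.
clearbody A B; move: (x * x) xx => y y0.
have := mulr_ge0 A0 y0; have := mulr_ge0 B0 E0.
by lra.
Qed.

Lemma near_LM_superlinear e : 0 < e ->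
  \forall z \near z0, forall d, LM z d -> `|z + d - z0| <= e * `|z - z0|.
Proof.
move=> e0; have [K K0 hK] := near_LM_step.
have e2 : 0 < e / (2 * K) by rewrite divr_gt0// mulr_gt0.
have near_small : \forall z \near z0, `|z - z0| <= e / (2 * K).
  apply/nbhs_ballP; exists (e / (2 * K)) => // z.
  by rewrite -ball_normE/= distrC => /ltW.
apply: filterS3 hK (near_remainders e2) near_small => z {}hK rem small d lm.
have E0 : 0 <= e / (2 * K) * `|z - z0| by rewrite mulr_ge0// ltW.
rewrite (le_trans (hK _ _ E0 rem lm))// expr2.
have : `|z - z0| * `|z - z0| <= e / (2 * K) * `|z - z0| by rewrite ler_wpM2r.
rewrite -(ler_pM2l K0) mulrDr.
have -> : K * (e / (2 * K) * `|z - z0|) = e / 2 * `|z - z0| by field; rewrite gt_eqF.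
by move: (K * (_ * _)) => a; lra.
Qed.

Lemma near_LM_quadratic :
  locally_lipschitz_jac G -> locally_lipschitz_jac H ->
  exists2 K : R, 0 < K & \forall z \near z0, forall d, LM z d ->
    `|z + d - z0| <= K * `|z - z0| ^+ 2.
Proof.
move=> lG lH; have [K K0 hK] := near_LM_step.
have [c c0 hc] := near_remainders_lipschitz lG lH.
exists (K * (c + 1)); first by rewrite mulr_gt0// addr_gt0.
apply: filterS2 hK hc => z {}hK rem d lm.
have E0 : 0 <= c * `|z - z0| ^+ 2 by rewrite mulr_ge0 ?sqr_ge0// ltW.
rewrite (le_trans (hK _ _ E0 rem lm))//.
by rewrite -mulrA ler_wpM2l ?(ltW K0)// mulrDl mul1r.
Qed.

(** By the error bound, contraction of the distance becomes contraction of the residual. The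
    residual shrinks by kappa, hence its square by kappa^2 <= kappa. *)
Lemma near_decrease_test :
  \forall z \near z0, forall d, LM z d -> decrease_test H G kappa z d.
Proof.
have [M M0 hM] := near_FFB_error_bound.
have /andP[k0 k1] := kappa01.
pose m : R := (q1 + p2)%:R; have m0 : 0 <= m by [].
(* Chosen so that m M^2 e <= kappa, while e <= 1 keeps z + d in the ball where the error bound
   holds. *)
pose e := kappa / (m * M ^+ 2 + kappa).
have D0 : 0 < m * M ^+ 2 + kappa by rewrite ltr_wpDl// mulr_ge0 ?sqr_ge0.
have e0 : 0 < e by rewrite divr_gt0.
have e1 : e <= 1 by rewrite ler_pdivrMr// mul1r lerDr mulr_ge0 ?sqr_ge0.
have /nbhs_ballP[r /= r0 hr] := hM.
have near_r : \forall z \near z0, `|z - z0| < r.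
  by apply/nbhs_ballP; exists r => // z; rewrite -ball_normE/= distrC.
apply: filterS2 (near_LM_superlinear e0) near_r => z {}hz zr d lm.
have zd := hz d lm.
have [_ hz1] := hr z ltac:(by rewrite -ball_normE/= distrC).
have [hzd _] : `|FFB H G (z + d)| <= M * `|z + d - z0| /\
    `|z + d - z0| <= M * `|FFB H G (z + d)|.
  apply: hr; rewrite -ball_normE/= distrC (le_lt_trans zd)//.
  by rewrite (le_lt_trans _ zr)// ler_piMl.
have key : enorm (FFB H G (z + d)) <= kappa * enorm (FFB H G z).
  rewrite (le_trans (enorm_le_norm _))// -/m.
  rewrite (@le_trans _ _ (m * (M * (e * (M * `|FFB H G z|)))))//.
    rewrite ler_wpM2l// (le_trans hzd)// ler_pM2l// (le_trans zd)//.
    by rewrite ler_pM2l.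
  rewrite (_ : _ * _ = (m * M ^+ 2 * e) * `|FFB H G z|); last by ring.
  have me : m * M ^+ 2 * e <= kappa.
    by rewrite /e mulrCA ler_piMr ?(ltW k0)// ler_pdivrMr// mul1r lerDl ltW.
  rewrite ler_pM// ?norm_le_enorm//.
  by rewrite mulr_ge0 ?(ltW e0)// mulr_ge0 ?sqr_ge0.
rewrite /decrease_test /PsiFB [X in _ <= X]mulrCA ler_pM2l ?invr_gt0//.
rewrite (@le_trans _ _ ((kappa * enorm (FFB H G z)) ^+ 2))//.
  by rewrite ler_sqr ?nnegrE ?mulr_ge0 ?enorm_ge0// ltW.
rewrite exprMn ler_wpM2r ?sqr_ge0// expr2 ler_piMl ?ltW//.
Qed.

Variables tau_abs sigma beta rho1 rho2 : R.
Variables z d : nat -> 'cV[R]_(p1 + p2).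
Hypothesis gen :
  GLM_generated H G kappa tau_abs sigma beta rho1 rho2 gamma1 gamma2 z d.
Hypothesis z0_cluster : cluster (z @ \oo) z0.

Lemma GLM_LM k : LM (z k) (d k).
Proof. by have [_ [[]]] := gen k. Qed.

(** The cluster point supplies one iterate in a ball where the test succeeds and the distance at
    least halves; the next iterate stays in that ball, and induction continues. *)
Lemma GLM_eventually_contracting : exists N, exists2 r : R, 0 < r &
  forall k, (N <= k)%N -> [/\ z k.+1 = z k + d k, `|z k - z0| < r
    & `|z k.+1 - z0| <= 2^-1 * `|z k - z0|].
Proof.
have half0 : 0 < 2^-1 :> R by rewrite invr_gt0.
have : \forall x \near z0, forall d, LM x d ->
    decrease_test H G kappa x d /\ `|x + d - z0| <= 2^-1 * `|x - z0|.
  apply: filterS2 near_decrease_test (near_LM_superlinear half0) => x h1 h2 e lm.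
  by split; [exact: h1|exact: h2].
move=> /nbhs_ballP[r /= r0 hr].
have near_r : \forall z \near z0, `|z - z0| < r.
  by apply/nbhs_ballP; exists r => // y; rewrite -ball_normE/= distrC.
have [N _ zN] := cluster_frequently 0 z0_cluster near_r.
have step k : `|z k - z0| < r ->
    z k.+1 = z k + d k /\ `|z k.+1 - z0| <= 2^-1 * `|z k - z0|.
  move=> zk; have zkr : ball z0 r (z k) by rewrite -ball_normE/= distrC.
  by have [t c] := hr _ zkr _ (GLM_LM k); rewrite (test_step gen t).
exists N, r => // k; elim: k => [|k IH].
  by rewrite leqn0 => /eqP N0; rewrite N0 in zN; have [] := step _ zN.
rewrite leq_eqVlt => /predU1P[kN|]; first by rewrite -kN; have [] := step _ zN.
rewrite ltnS => /IH[_ zk zk1].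
have zkr : `|z k.+1 - z0| < r.
  by rewrite (le_lt_trans zk1)// (le_lt_trans _ zk)// ler_piMl// invf_le1// ler1n.
by have [] := step _ zkr.
Qed.

Lemma GLM_eventually_LM_step : \forall k \near \oo, z k.+1 = z k + d k.
Proof.
by have [N [r _ hr]] := GLM_eventually_contracting; exists N => // k /= /hr[].
Qed.

Lemma GLM_cvg : z @ \oo --> z0.
Proof.
have [N [r r0 hr]] := GLM_eventually_contracting.
have geo k : `|z (k + N)%N - z0| <= 2^-1 ^+ k * r.
  elim: k => [|k IH]; first by rewrite mul1r; have [_ /ltW] := hr _ (leqnn N).
  have [_ _ h] := hr _ (leq_addl k N); rewrite addSn (le_trans h)//.
  by rewrite exprS -mulrA ler_pM2l ?invr_gt0.
apply/(@cvgrPdist_le _ _ _ \oo) => e e0.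
have : (fun k => (2^-1 : R) ^+ k) @ \oo --> (0 : R).
  by apply: cvg_expr; rewrite ger0_norm ?invr_ge0// invf_lt1// ltr1n.
have er : 0 < e / r by rewrite divr_gt0.
move=> /cvgrPdist_le/(_ _ er)[N' _ hN'].
exists (N' + N)%N => // k /= hk.
have kN : (N <= k)%N by rewrite (leq_trans _ hk)// leq_addl.
have hk' : (N' <= k - N)%N by rewrite -(leq_add2r N) subnK.
have := geo (k - N)%N; rewrite subnK// distrC => /le_trans; apply.
rewrite -ler_pdivlMr//.
have := hN' _ hk'; rewrite /= sub0r normrN; exact: le_trans (ler_norm _).
Qed.

Lemma GLM_superlinear : superlinear_cvg z z0.
Proof.
split; first exact: GLM_cvg.
apply/eqoP => e e0.
(* Factor for passing from the maximum norm to the Euclidean one; the successor keeps it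
   positive. *)
pose n : R := (p1 + p2).+1%:R.
have n0 : 0 < n by [].
have en : 0 < e / n by rewrite divr_gt0.
have hz := GLM_cvg (near_LM_superlinear en).
apply: filterS2 GLM_eventually_LM_step hz => k zk /(_ _ (GLM_LM k)).
rewrite -zk !ger0_norm ?enorm_ge0// => h.
rewrite (le_trans (enorm_le_norm _))//.
rewrite (@le_trans _ _ (n * `|z k.+1 - z0|))//; first by rewrite ler_wpM2r// ler_nat.
rewrite (@le_trans _ _ (n * (e / n * `|z k - z0|)))//; first by rewrite ler_pM2l.
rewrite mulrA mulrCA divff ?gt_eqF// mulr1 ler_pM2l//; exact: norm_le_enorm.
Qed.

Lemma GLM_quadratic : locally_lipschitz_jac G -> locally_lipschitz_jac H ->
  quadratic_cvg z z0.
Proof.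
move=> lG lH; split; first exact: GLM_cvg.
have [K K0 hK] := near_LM_quadratic lG lH.
pose n : R := (p1 + p2).+1%:R.
have n0 : 0 < n by [].
apply/eqO_exP; exists (n * K); first exact: mulr_gt0.
have hz := GLM_cvg hK.
apply: filterS2 GLM_eventually_LM_step hz => k zk /(_ _ (GLM_LM k)).
rewrite -zk ger0_norm ?enorm_ge0// [X in _ -> _ <= _ * X]ger0_norm ?sqr_ge0// => h.
rewrite (le_trans (enorm_le_norm _))//.
rewrite (@le_trans _ _ (n * `|z k.+1 - z0|))//; first by rewrite ler_wpM2r// ler_nat.
rewrite -mulrA ler_pM2l// (le_trans h)// ler_pM2l//.
by rewrite ler_sqr ?nnegrE ?enorm_ge0// norm_le_enorm.
Qed.

End FastConvergence.

(* [tau_abs = 0] switches the stopping test off; with [0 < tau_abs] an infinite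
   run keeps the residual away from 0, so parts (a) and (c) would be vacuous. *)
Theorem theorem4p6 (R : realType) (p1 p2 q1 : nat)
  (H : 'cV[R]_(p1 + p2) -> 'cV[R]_q1) (G : 'cV[R]_(p1 + p2) -> 'cV[R]_p2)
  (HC1 : continuously_differentiable H) (GC1 : continuously_differentiable G)
  (kappa tau_abs sigma beta rho1 rho2 gamma1 gamma2 : R)
  (kappa01 : 0 < kappa < 1) (tau_ge0 : 0 <= tau_abs)
  (sigma01 : 0 < sigma < 1) (beta01 : 0 < beta < 1)
  (rho1_gt0 : 0 < rho1) (rho2_gt0 : 0 < rho2)
  (gamma1_gt0 : 0 < gamma1) (gamma2_gt0 : 0 < gamma2)
  (z d : nat -> 'cV[R]_(p1 + p2))
  (gen : GLM_generated H G kappa tau_abs sigma beta rho1 rho2 gamma1 gamma2 z d) :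
  [/\ (* (a) *)
      infinite_set [set k | decrease_test H G kappa (z k) (d k)] ->
        PsiFB H G (z k) @[k --> \oo] --> (0 : R) /\
        (forall zbar, cluster (z @ \oo) zbar -> MNLCS H G zbar),
      (* (b) *)
      forall zbar, cluster (z @ \oo) zbar -> grad (PsiFB H G) zbar = 0
    & (* (c) *)
      forall zbar, cluster (z @ \oo) zbar -> MNLCS H G zbar ->
        (forall I : {set 'I_p2}, I \subset I00 G zbar ->
           row_free (CQ_mx H G zbar I)^T) ->
        superlinear_cvg z zbar /\
        (locally_lipschitz_jac G -> locally_lipschitz_jac H ->
           quadratic_cvg z zbar)].
Proof.
split.
- move=> inft; split.
    apply/(@cvgrPdist_lt _ R^o _ \oo) => e e0.
    have [N hN] := PsiFB_null kappa01 sigma01 beta01 rho1_gt0 gen inft e0.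
    exists N => // k /= /hN; rewrite sub0r normrN ger0_norm//; exact: PsiFB_ge0.
  move=> x cx; apply: FFB_eq0_MNLCS.
  exact: (PsiFB_cluster0 HC1 GC1 kappa01 sigma01 beta01 rho1_gt0 gen inft cx).
- move=> x cx; exact: (cluster_stationary HC1 GC1 kappa01 sigma01 beta01
    rho1_gt0 rho2_gt0 gen cx).
move=> x cx sol CQ; split.
  exact: (GLM_superlinear HC1 GC1 sol CQ kappa01 gamma1_gt0 gamma2_gt0 gen cx).
exact: (GLM_quadratic HC1 GC1 sol CQ kappa01 gamma1_gt0 gamma2_gt0 gen cx).
Qed.
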